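(* For every integer $n\ge 2$, the chain $\operatorname{SU}(n)\subset\operatorname{SO}(2n)\subset\operatorname{SO}(2n+1)$ satisfies the bracket condition (BC); that is, with $H=\operatorname{SU}(n)$, $K=\operatorname{SO}(2n)$, $G=\operatorname{SO}(2n+1)$, there exists a constant $C>0$ such that for all $X,Y\in\mathfrak p$, $$\bigl|[X^{\mathfrak m},Y^{\mathfrak m}]^{\mathfrak m}\bigr|\le C\,\bigl|[X,Y]\bigr|.$$
   Context: The embeddings are the standard ones: $\operatorname{SO}(2n)\subset\operatorname{SO}(2n+1)$ fixes the last standard basis vector; and $\operatorname{SU}(n)\subset\operatorname{U}(n)\subset\operatorname{SO}(2n)$, where $\mathbf R^{2n}\cong\mathbf C^n$ via a standard orthogonal complex structure $J$ (block diagonal with $n$ blocks $\begin{pmatrix}0&-1\\1&0\end{pmatrix}$), so that $\mathfrak u(n)=\{A\in\mathfrak{so}(2n): AJ=JA\}=\mathfrak{su}(n)\oplus\mathbf R J$. Let $\mathfrak h\subset\mathfrak k\subset\mathfrak g$ be the Lie algebras of $H\subset K\subset G$ and let $g_0$ be a biinvariant inner product on $\mathfrak g$ with norm $|\cdot|$. Let $\mathfrak m$ be the $g_0$-orthogonal complement of $\mathfrak h$ in $\mathfrak k$, $\mathfrak s$ the $g_0$-orthogonal complement of $\mathfrak k$ in $\mathfrak g$, and $\mathfrak p=\mathfrak m\oplus\mathfrak s$. For $X\in\mathfrak g$, $X^{\mathfrak m}$ denotes the $g_0$-orthogonal projection of $X$ to $\mathfrak m$. The bracket condition (BC) is the displayed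 condition in the claim. *)

(* Defs.v *)
From HB Require Import structures.
From mathcomp Require Import all_boot all_order all_algebra.
From mathcomp Require Import complex mxtens.
From mathcomp Require Import all_classical all_reals all_analysis.

Set Implicit Arguments.
Unset Strict Implicit.
Unset Printing Implicit Defensive.

Import Order.TTheory GRing.Theory Num.Theory.
Import numFieldNormedType.Exports.

Local Open Scope classical_set_scope.
Local Open Scope ring_scope.

Section LieTheory.
Context {R : realType} {N : nat}.
Implicit Types (G H K : set 'M[R]_N) (V U : set 'M[R]_N) (X Y Z : 'M[R]_N).

(* The tangent space at 1 of a closed matrix group: the velocities at time 0 of
   the curves in the group that pass through 1 and are differentiable then. *)
Definition lie_algebra G : set 'M[R]_N :=
  [set A | exists c : R -> 'M[R]_N,
     [/\ forall t, G (c t), c 0 = 1%:M & is_derive (0 : R) (1 : R) c A]].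

Definition lie_bracket X Y : 'M[R]_N := X *m Y - Y *m X.

(* Only the values of [g] on [V] matter. *)
Definition inner_product_on V (g : 'M[R]_N -> 'M[R]_N -> R) : Prop :=
  [/\ forall a X Y Z, V X -> V Y -> V Z ->
        g (a *: X + Y) Z = a * g X Z + g Y Z,
      forall X Y, V X -> V Y -> g X Y = g Y X &
      forall X, V X -> X != 0 -> 0 < g X X].

(* For a group G, biinvariance of the left-invariant metric with value [g] at 1
   is Ad(G)-invariance of [g]. *)
Definition biinvariant_inner_product G (g : 'M[R]_N -> 'M[R]_N -> R) : Prop :=
  inner_product_on (lie_algebra G) g /\
  forall Q, G Q -> forall X Y, lie_algebra G X -> lie_algebra G Y ->
    g (Q *m X *m invmx Q) (Q *m Y *m invmx Q) = g X Y.

Section InnerProduct.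
Variable g : 'M[R]_N -> 'M[R]_N -> R.

Definition ip_norm X : R := Num.sqrt (g X X).

Definition orth_compl U V : set 'M[R]_N :=
  [set X | V X /\ forall Z, U Z -> g X Z = 0].

Definition orth_proj U X : 'M[R]_N :=
  xget 0 [set P | U P /\ forall Z, U Z -> g (X - P) Z = 0].

Definition sum_space U V : set 'M[R]_N :=
  [set X | exists A B, [/\ U A, V B & X = A + B]].

Definition bracket_condition H K G : Prop :=
  let h := lie_algebra H in
  let k := lie_algebra K in
  let m := orth_compl h k in
  let s := orth_compl k (lie_algebra G) in
  let p := sum_space m s in
  let proj_m := orth_proj m in
  exists2 C : R, 0 < C &
    forall X Y, p X -> p Y ->
      ip_norm (proj_m (lie_bracket (proj_m X) (proj_m Y)))
        <= C * ip_norm (lie_bracket X Y).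

End InnerProduct.
End LieTheory.

Section Groups.
Variable R : realType.

Definition SO (N : nat) : set 'M[R]_N :=
  [set A | A^T *m A = 1%:M /\ \det A = 1].

Definition SU (n : nat) : set 'M[R[i]]_n :=
  [set U | U \is unitarymx /\ \det U = 1].

Definition rot90 : 'M[R]_2 :=
  \matrix_(i, j) (if (i == 1) && (j == 0) then 1
                  else if (i == 0) && (j == 1) then -1 else 0).

(* C^n is identified with R^(2n) by z_k = x_(2k) + i x_(2k+1), so that each
   entry a + bi becomes the 2 x 2 block (a, -b; b, a). In particular i * Id
   becomes J = 1%:M *t rot90. *)
Definition realify (n : nat) (U : 'M[R[i]]_n) : 'M[R]_(n * 2) :=
  map_mx (@complex.Re R) U *t 1%:M + map_mx (@complex.Im R) U *t rot90.

Definition fix_last (N : nat) (A : 'M[R]_N) : 'M[R]_(N + 1) :=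
  block_mx A 0 0 1%:M.

End Groups.

Arguments SO R N : clear implicits.
Arguments SU R n : clear implicits.

(* Main.v *)
Require Import Defs.
From mathcomp Require Import all_boot all_order all_algebra all_fingroup.
From mathcomp Require Import complex mxtens ring lra.
From mathcomp Require Import all_classical all_reals all_analysis.

(* Write X = (A, x) and Y = (B, y) with A, B in m and x, y in R^(2n), so that
   [X, Y] has the components E = [A, B] - wedge x y and A y - B x. Elements of m
   are of the form a J + A' with A' skew and anticommuting with J. It suffices to
   bound wedge x y by [X, Y], and a linear change of the pair (X, Y) reduces this
   to the case where x, y are orthonormal and B anticommutes with J.

   The number theta = <y, J x> is O(|E|): let alpha, beta be the complex skew
   matrices of the antilinear maps A', B, and put gam = beta + i alpha and
   tau = beta - i alpha. Up to E, the matrix gam gam^* - tau tau^* is a Hermitian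
   form of trace -2 theta that vanishes on the hyperplane orthogonal to x. So the
   eigenvalues of gam gam^* and tau tau^* interlace up to one step; being of even
   multiplicity, they agree up to O(|E|), and so do the traces.

   With theta close to 0, the coefficient a satisfies two incompatible equations:
   a^2 = 1/4 and a^2 = 1/12 up to O(|[X, Y]|). *)

Set Implicit Arguments.
Unset Strict Implicit.
Unset Printing Implicit Defensive.

Import Order.TTheory GRing.Theory Num.Theory.
Import numFieldNormedType.Exports.
Local Open Scope classical_set_scope.
Local Open Scope ring_scope.

(** * Eigenvalue interlacing for skew matrices *)

(** The obstacle is the lack of compactness: even with [x], [y] orthonormal, the components in m
    range over an unbounded set, so showing that [X, Y] never vanishes would give no uniform
    constant. Every step is therefore an inequality whose error is linear in a bound [e] for [X, Y].
    The change of the pair is harmless because it multiplies [X, Y] and [wedge x y] by the same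
    determinant. A bound for [wedge x y] suffices, since [A, B] is the upper-left block of [X, Y]
    plus [wedge x y]. The inner product is an arbitrary biinvariant one. In size at least 5, which n
    >= 2 provides, it is shown to be a positive multiple of the Frobenius product, so norms can be
    compared with entries. The Lie algebra of SU(n) is never determined: three families of its
    elements are exhibited, and orthogonality to these already forces the shape a J + A'. *)

Lemma det_skew_odd (F : numFieldType) d (K : 'M[F]_d) :
  K^T = - K -> odd d -> \det K = 0.
Proof.
move=> KT od; have : \det K = - \det K.
  by rewrite -{1}(det_tr K) KT -scaleN1r detZ -signr_odd od expr1 mulN1r.
by move/eqP; rewrite -addr_eq0 -mulr2n mulrn_eq0 => /eqP.
Qed.

Section SkewSingularValues.
Local Open Scope sesquilinear_scope.
Variable R : rcfType.
Local Notation C := R[i].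

(** As [K] is skew, [K^t* *m K] is the conjugate of [K *m K^t*], hence the same real diagonal
    matrix. So [K] commutes with it and is block diagonal along the level sets of [t]. The block
    over [I] is skew and, [t] being nonzero there, invertible; in odd size its determinant would
    vanish. *)
Lemma skew_support_even n (K : 'M[C]_n) (t : 'I_n -> C) (I : {pred 'I_n}) :
    K^T = - K -> K *m K^t* = diag_mx (\row_j t j) ->
    (forall j, (t j)^* = t j) ->
    (forall j k, j \in I -> t k = t j -> k \in I) ->
    (forall j, j \in I -> t j != 0) -> ~~ odd #|I|.
Proof.
move=> KT KK tr Icl I0; set d := #|I|.
have KT' : K^t* = - map_mx Num.conj K by rewrite KT map_mxN.
have KK2 : K^t* *m K = diag_mx (\row_j t j).
  have /(congr1 (map_mx Num.conj)) := KK.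
  rewrite map_mxM KT' map_mxN mulmxN mulNmx map_diag_mx.
  have -> : map_mx Num.conj (map_mx Num.conj K) = K.
    by apply/matrixP => i j; rewrite !mxE conjCK.
  move=> ->; congr diag_mx; apply/matrixP => i j; rewrite !mxE; exact: tr.
have comm j k : t j * K j k = K j k * t k.
  have : (K *m K^t* *m K) j k = (K *m (K^t* *m K)) j k by rewrite mulmxA.
  by rewrite KK KK2 mul_diag_mx mul_mx_diag !mxE.
have K0 j k : j \in I -> k \notin I -> K j k = 0.
  move=> jI kI; apply/eqP/contraT => nz; case/negP: kI; apply: (Icl j) => //.
  by apply: (mulfI nz); rewrite -comm mulrC.
pose L := mxsub (@enum_val _ I) (@enum_val _ I) K : 'M[C]_d.
have LL : L *m L^t* = diag_mx (\row_j t (enum_val j)).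
  apply/matrixP => j k; rewrite !mxE.
  have /matrixP/(_ (enum_val j) (enum_val k)) := KK; rewrite !mxE.
  rewrite (bigID (mem I)) /= [X in _ + X]big1 ?addr0; last first.
    by move=> i iI; rewrite K0 ?mul0r// enum_valP.
  have -> : (enum_val j == enum_val k) = (j == k).
    by rewrite (inj_eq enum_val_inj).
  move=> <-; rewrite (reindex_onto (@enum_val _ I) (enum_rank_in (enum_valP j))) /=.
    by apply: eq_big => [i|i _]; rewrite ?mxE // enum_valP enum_valK_in eqxx.
  by move=> i iI; rewrite enum_rankK_in.
apply/negP => od.
have LT : L^T = - L.
  by apply/matrixP => i j; rewrite !mxE; have /matrixP/(_ (enum_val i) (enum_val j)) := KT; rewrite !mxE.
have := congr1 determinant LL; rewrite det_mulmx (det_skew_odd LT od) mul0r det_diag.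
move/esym/eqP; rewrite prodf_seq_eq0 => /hasP[i _] /=.
by rewrite mxE; apply/negP/I0/enum_valP.
Qed.

(** The counting clause is the form in which even multiplicity is used; it stands in for the Youla
    normal form of a complex skew matrix. *)
Lemma skew_singular_values n (K : 'M[C]_n) : K^T = - K ->
  exists (U : 'M[C]_n) (t : 'I_n -> R),
    [/\ U \is unitarymx, K *m K^t* = U^t* *m diag_mx (\row_j (t j)%:C%C) *m U,
        forall j, 0 <= t j &
        forall s, 0 <= s -> ~~ odd #|[pred j | s < t j]|].
Proof.
move=> KT; pose T := K *m K^t*.
have Th : T \is hermsymmx.
  apply/is_hermitianmxP; rewrite expr0 scale1r /T trmx_mul map_mxM.
  by rewrite trmxCK.
pose U := spectralmx T; pose sp := spectral_diag T.
have Uu : U \is unitarymx := spectral_unitarymx T.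
have /mxOverP spr := hermitian_spectral_diag_real Th.
have TE : T = U^t* *m diag_mx sp *m U.
  have /orthomx_spectralP := hermitian_normalmx Th.
  by rewrite -/U -/sp (invmx_unitary Uu).
pose t j := complex.Re (sp 0 j).
have tE : sp = \row_j (t j)%:C%C.
  by apply/rowP => j; rewrite mxE RRe_real // spr.
have UU : U *m U^t* = 1%:M by apply/unitarymxP.
have UU' : U^t* *m U = 1%:M by apply: mulmx1C.
(* Multiplying by [U^T] on the right, rather than by the adjoint of [U], keeps the matrix skew.
   Since [U^T] is unitary too, it cancels in [K' *m K'^t*], which is therefore the diagonalised
   [T]. *)
pose K' := U *m K *m U^T.
have K'T : K'^T = - K'.
  by rewrite /K' !trmx_mul trmxK KT mulNmx mulmxN mulmxA.
have UTc : U^T *m (U^T)^t* = 1%:M.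
  have := congr1 (map_mx Num.conj) UU'; rewrite map_mxM map_mx1.
  have -> : map_mx Num.conj (U^t*) = U^T.
    by apply/matrixP => i j; rewrite !mxE conjCK.
  by rewrite trmxK.
have K'K : K' *m K'^t* = diag_mx sp.
  rewrite /K' !trmx_mul !map_mxM !mulmxA -(mulmxA (U *m K)) UTc mulmx1.
  rewrite -(mulmxA U) -/T TE !mulmxA UU mul1mx -mulmxA UU mulmx1 //.
exists U, t; split; [exact: Uu | by rewrite -tE | |].
  move=> j; have /matrixP/(_ j j) := K'K; rewrite tE !mxE eqxx mulr1n => e.
  rewrite -lecR -e; apply: sumr_ge0 => i _; rewrite !mxE; exact: mul_conjC_ge0.
move=> s s0; apply: (@skew_support_even _ K' (fun j => (t j)%:C%C)) => //.
- by rewrite -tE.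
- by move=> j; apply/CrealP; rewrite complex_real.
- by move=> j k; rewrite !inE => sj [->].
- move=> j; rewrite !inE => sj; have : (0 < t j) := le_lt_trans s0 sj.
  by rewrite -ltcR lt_def => /andP[].
Qed.

(** After sorting both families decreasingly, the comparison holds term by term. If entry k (from 0)
    of [t] exceeded that of [g] by more than [d], take for [s] this entry of [g]: at least k + 1
    values of [t] lie above [s + d], but at most k values of [g] lie above [s]. *)
Lemma sumr_le_of_counts n (t g : 'I_n -> R) (d : R) :
    (forall j, 0 <= g j) ->
    (forall s, 0 <= s -> (#|[pred j | (s + d < t j)%R]| <= #|[pred j | (s < g j)%R]|)%N) ->
  \sum_j t j <= \sum_j (g j + d).
Proof.
move=> g0 cnt.
have srt (f : 'I_n -> R) : exists q : seq R, [/\ perm_eq q (map f (enum 'I_n)),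
    sorted >=%R q & size q = n].
  exists (sort >=%R (map f (enum 'I_n))); split.
  - by rewrite perm_sort.
  - by apply: sort_sorted => x y; exact: le_total.
  - by rewrite size_sort size_map size_enum_ord.
have cntE (f : 'I_n -> R) (q : seq R) s : perm_eq q (map f (enum 'I_n)) ->
    #|[pred j | s < f j]| = count (fun x => s < x) q.
  by move=> /seq.permP->; rewrite count_map cardE {1}/enum_mem size_filter enumT.
have [p [pP ps pz]] := srt t; have [q [qP qs qz]] := srt g.
have sumE (f : 'I_n -> R) (r : seq R) : perm_eq r (map f (enum 'I_n)) -> size r = n ->
    \sum_j f j = \sum_(j < n) r`_j.
  move=> rP rz; rewrite -big_enum -(big_map f xpredT id) -(perm_big _ rP) /=.
  by rewrite (big_nth 0) rz big_mkord.
rewrite big_split /= (sumE _ _ pP pz) (sumE _ _ qP qz) -big_split /=.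
apply: ler_sum => k _; rewrite leNgt; apply/negP => lt.
have q0 : 0 <= q`_k.
  have : q`_k \in q by rewrite mem_nth // qz.
  by rewrite (perm_mem qP) => /mapP[j _ ->].
have := cnt _ q0; rewrite (cntE _ _ _ pP) (cntE _ _ _ qP) leqNgt => /negP; apply.
have dec (r : seq R) i j : sorted >=%R r -> size r = n -> (i <= j)%N ->
    (j < n)%N -> r`_j <= r`_i.
  move=> rs rz ij jn; have tr : transitive (>=%R : rel R).
    by move=> x y z /= h1 h2; apply: le_trans h2 h1.
  apply: (sorted_leq_nth tr (@lexx _ R) 0 rs) => //; rewrite inE rz //.
  exact: leq_ltn_trans jn.
apply: (@leq_trans k.+1).
  rewrite ltnS -[X in count _ X](cat_take_drop k q) count_cat [X in (_ + X)%N](_ : _ = 0%N) ?addn0.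
    by apply: leq_trans (count_size _ _) _; rewrite size_take qz ltn_ord.
  apply/eqP; rewrite -leqn0 leqNgt -has_count; apply/hasPn => x xd; have [i  + <-] := nthP 0 xd.
  rewrite size_drop qz => ilt; rewrite nth_drop -leNgt.
  by apply: (dec q) => //; rewrite ?leq_addr // -ltn_subRL.
have /allP al : all (fun x => q`_k + d < x) (take k.+1 p).
  apply/allP => x xd; have [i + <-] := nthP 0 xd; rewrite size_take pz => ilt.
  have ik : (i < k.+1)%N by apply: leq_trans ilt _; case: ifP => // /negbT; rewrite -leqNgt.
  rewrite nth_take //; apply: lt_le_trans lt _.
  exact: dec.
rewrite -(cat_take_drop k.+1 p) count_cat.
have /eqP -> : count (fun x => q`_k + d < x) (take k.+1 p) == size (take k.+1 p).
  by rewrite -all_count; apply/allP.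
rewrite size_takel ?pz //; exact: leq_addr.
Qed.

Lemma diag_form n (U : 'M[C]_n) (t : 'I_n -> C) (u : 'rV[C]_n) :
  (u *m (U^t* *m diag_mx (\row_j t j) *m U) *m u^t*) 0 0 =
    \sum_j t j * `|(u *m U^t*) 0 j| ^+ 2.
Proof.
pose z := u *m U^t*.
have zE : U *m u^t* = z^t* by rewrite /z trmx_mul map_mxM trmxCK.
rewrite !mulmxA -/z -mulmxA zE mul_mx_diag mxE; apply: eq_bigr => j _.
by rewrite !mxE normCK mulrAC mulrC.
Qed.

Section Weyl.
Variables (n : nat) (K L : 'M[C]_n) (v : 'cV[C]_n) (d : R).
Hypothesis KL : forall u : 'rV[C]_n, u *m v = 0 ->
  (u *m (K *m K^t*) *m u^t*) 0 0 <=
    (u *m (L *m L^t*) *m u^t*) 0 0 + d%:C%C * (u *m u^t*) 0 0.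
Variables (U V : 'M[C]_n) (t g : 'I_n -> R).
Hypotheses (Uu : U \is unitarymx) (Vu : V \is unitarymx).
Hypothesis KE : K *m K^t* = U^t* *m diag_mx (\row_j (t j)%:C%C) *m U.
Hypothesis LE : L *m L^t* = V^t* *m diag_mx (\row_j (g j)%:C%C) *m V.

(** A dimension count. In the span of the rows of [U] over [I], orthogonality to the rows of [V]
    over [J] and [u *m v = 0] are #|J| + 1 linear conditions. If #|I| is larger, a nonzero [u]
    satisfies them: its form for [K] exceeds s + d times its squared norm while that for [L] is at
    most s times it, against [KL]. *)
Lemma weyl_count s : 0 <= s ->
  (#|[pred j | (s + d < t j)%R]| <= #|[pred j | (s < g j)%R]|.+1)%N.
Proof.
move=> s0; rewrite leqNgt; apply/negP.
set I := [pred j | (s + d < t j)%R]; set J := [pred j | (s < g j)%R] => lt.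
pose M1 := rowsub (@enum_val _ I) U.
pose M2 := row_mx (colsub (@enum_val _ J) (V^t*)) v.
have /rowV0Pn[w] : kermx (M1 *m M2) != 0.
  rewrite -mxrank_eq0 mxrank_ker -lt0n subn_gt0.
  by apply: leq_ltn_trans (rank_leq_col _) _; rewrite addn1.
move/sub_kermxP; rewrite mulmxA; set u := w *m M1 => uM w0.
have uM' : u *m colsub (@enum_val _ J) (V^t*) = 0 /\ u *m v = 0.
  by move: uM; rewrite mul_mx_row -[0]row_mx0 => /eq_row_mx.
have y0 k : k \in J -> (u *m V^t*) 0 k = 0.
  move=> kJ; have /matrixP/(_ 0 (enum_rank_in kJ k)) := uM'.1.
  by rewrite mulmx_colsub !mxE enum_rankK_in.
have zE : u *m U^t* = w *m rowsub (@enum_val _ I) 1%:M.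
  rewrite /u -mulmxA /M1 -(unitarymxP Uu) -mul_rowsub_mx //.
have z0 j : j \notin I -> (u *m U^t*) 0 j = 0.
  move=> jI; rewrite zE mxE big1 // => a _; rewrite !mxE.
  case: eqP => [e|]; last by rewrite mulr0.
  by case/negP: jI; rewrite -e enum_valP.
have zI a : (u *m U^t*) 0 (enum_val a) = w 0 a.
  rewrite zE mxE (bigD1 a) //= !mxE eqxx mulr1 big1 ?addr0 // => b ba.
  by rewrite !mxE (inj_eq enum_val_inj) (negbTE ba) mulr0.
have nE (W : 'M[C]_n) : W \is unitarymx -> (u *m u^t*) 0 0 = \sum_j `|(u *m W^t*) 0 j| ^+ 2.
  move=> Wu; have := diag_form W (fun=> 1) u.
  have -> : diag_mx (\row_(j < n) 1) = 1%:M :> 'M[C]_n.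
    by apply/matrixP => i j; rewrite !mxE.
  rewrite mulmx1 (mulmx1C (unitarymxP Wu)) mulmx1 => ->.
  by apply: eq_bigr => j _; rewrite mul1r.
have := KL uM'.2; rewrite KE LE !diag_form (nE _ Uu) => le1.
have le2 : \sum_j (g j)%:C%C * `|(u *m V^t*) 0 j| ^+ 2 <= s%:C%C * (u *m u^t*) 0 0.
  rewrite (nE _ Vu) mulr_sumr; apply: ler_sum => j _.
  case jJ : (j \in J); first by rewrite y0 // normr0 expr0n /= !mulr0.
  apply: ler_wpM2r; first exact: exprn_ge0.
  by rewrite lecR leNgt; move: jJ; rewrite inE => ->.
have : \sum_j ((t j)%:C%C - (s + d)%:C%C) * `|(u *m U^t*) 0 j| ^+ 2 <= 0.
  under eq_bigr do rewrite mulrBl; rewrite sumrB subr_le0 -mulr_sumr.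
  rewrite rmorphD mulrDl -[X in X * _ + _]/(s%:C%C) -{1}(nE _ Uu).
  by apply: le_trans le1 _; rewrite lerD2r.
have ge0 j : 0 <= ((t j)%:C%C - (s + d)%:C%C) * `|(u *m U^t*) 0 j| ^+ 2.
  case jI : (j \in I); last by rewrite z0 ?jI // normr0 expr0n /= mulr0.
  apply: mulr_ge0; last exact: exprn_ge0.
  by rewrite subr_ge0 lecR ltW //; move: jI; rewrite inE.
move=> le0; have /eqP : \sum_j ((t j)%:C%C - (s + d)%:C%C) * `|(u *m U^t*) 0 j| ^+ 2 = 0.
  by apply/eqP; rewrite eq_le le0 sumr_ge0.
rewrite psumr_eq0 // => /allP al; case/negP: w0; apply/eqP/rowP => a.
have := al (enum_val a) (mem_index_enum _).
rewrite zI mulf_eq0 expf_eq0 /= normr_eq0 mxE => /orP[|/eqP//].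
have := enum_valP a; rewrite inE => lta.
by rewrite subr_eq0 => /eqP/complexI e; rewrite e ltxx in lta.
Qed.

End Weyl.

(* Weyl interlacing for a rank-one perturbation loses one eigenvalue, but the
   eigenvalues of [K K^*] above any level are even in number, [K] being skew;
   so nothing is lost. *)
Lemma skew_trace_le n (K L : 'M[C]_n) (v : 'cV[C]_n) (d : R) :
    0 <= d -> K^T = - K -> L^T = - L ->
    (forall u : 'rV[C]_n, u *m v = 0 ->
      (u *m (K *m K^t*) *m u^t*) 0 0 <=
        (u *m (L *m L^t*) *m u^t*) 0 0 + d%:C%C * (u *m u^t*) 0 0) ->
  \tr (K *m K^t*) <= \tr (L *m L^t*) + (d *+ n)%:C%C.
Proof.
move=> d0 KT LT le.
have [U [t [Uu KE t0 tev]]] := skew_singular_values KT.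
have [V [g [Vu LE g0 gev]]] := skew_singular_values LT.
have trE (W : 'M[C]_n) (f : 'I_n -> R) : W \is unitarymx ->
    \tr (W^t* *m diag_mx (\row_j (f j)%:C%C) *m W) = (\sum_j f j)%:C%C.
  move=> Wu; rewrite mxtrace_mulC mulmxA (unitarymxP Wu) mul1mx mxtrace_diag.
  by rewrite raddf_sum; apply: eq_bigr => j _; rewrite mxE.
have -> : d *+ n = \sum_(j < n) d by rewrite sumr_const card_ord.
rewrite KE LE !trE // -rmorphD lecR -big_split; apply: sumr_le_of_counts => // s s0.
have sd0 : 0 <= s + d by rewrite addr_ge0.
have := weyl_count le Uu Vu KE LE s0; rewrite leq_eqVlt ltnS => /orP[/eqP e|//].
by have := tev _ sd0; rewrite e /= (gev _ s0).
Qed.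

End SkewSingularValues.

(** * Antilinear skew maps and the Kaehler angle *)

Section AntilinearBlocks.
Local Open Scope sesquilinear_scope.
Variable C : numClosedFieldType.
Local Notation conjm := (map_mx Num.conj).

Lemma conjmK m p (M : 'M[C]_(m, p)) : conjm (conjm M) = M.
Proof. by apply/matrixP => i j; rewrite !mxE conjCK. Qed.

Lemma conjm_scale_i m p (M : 'M[C]_(m, p)) : conjm ('i *: M) = - ('i *: conjm M).
Proof. by apply/matrixP => i j; rewrite !mxE rmorphM /= conjCi mulNr. Qed.

Lemma half_double m p (M : 'M[C]_(m, p)) : M = 2^-1 *: (M + M).
Proof.
by apply/matrixP => i j; rewrite !mxE -mulr2n -(mulr_natl (M i j)) mulKf // pnatr_eq0.
Qed.

Lemma gram_diff_ring n (a b c d : 'M[C]_n) :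
  (b + 'i *: a) *m (d - 'i *: c) - (b - 'i *: a) *m (d + 'i *: c) =
    'i *: (2 *: (a *m d - b *m c)).
Proof.
rewrite !mulmxDl !mulmxDr !mulNmx !mulmxN -!scalemxAl -!scalemxAr !scalerA -expr2 sqrCi.
by apply/matrixP => i j; rewrite !mxE; ring.
Qed.

Variables (n m : nat) (J : 'M[C]_m) (P : 'M[C]_(n, m)).
Hypothesis cJ : conjm J = J.
Hypothesis PJ : P *m J = 'i *: P.
Hypothesis PPt : P *m P^t* = 2%:M.
Hypothesis PtP : P^t* *m P = 1%:M - 'i *: J.

Let Q := conjm P.

(* [P] intertwines [J] with multiplication by [i], so a real matrix that
   anticommutes with [J] becomes the antilinear map [v |-> antilin A *m conj v]. *)
Definition antilin (A : 'M[C]_m) : 'M[C]_n := 2^-1 *: (P *m A *m P^T).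

(** [P^T *m Q] is the conjugate of [PtP], that is [1%:M + 'i *: J]; and anticommutation with [PJ]
    gives [P *m A *m ('i *: J) = P *m A]. So [P *m A *m P^T *m Q] is twice [P *m A], which explains
    the factor 1/2 in [antilin]. *)
Lemma antilinP (A : 'M[C]_m) : A *m J = - (J *m A) -> P *m A = antilin A *m Q.
Proof.
move=> AJ; have PQ : P^T *m Q = 1%:M + 'i *: J.
  have := congr1 conjm PtP; rewrite map_mxM map_mxB conjm_scale_i map_mx1 cJ.
  by rewrite opprK => <-; rewrite conjmK.
rewrite -scalemxAl -[_ *m _ *m Q]mulmxA PQ mulmxDr mulmx1 -scalemxAr -mulmxA AJ.
rewrite mulmxN mulmxA PJ -scalemxAl -scalerN scalerA.
by rewrite -expr2 sqrCi scaleN1r opprK -half_double.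
Qed.

Lemma antilin_skew (A : 'M[C]_m) : A^T = - A -> (antilin A)^T = - antilin A.
Proof.
by move=> AT; rewrite /antilin linearZ /= !trmx_mul trmxK AT mulNmx mulmxN mulmxA scalerN.
Qed.

(** A product of two antilinear maps is linear, with matrix [alpha *m conjm beta], so the commutator
    becomes a difference of two such products. [gam] and [tau] are chosen so that exactly these
    cross terms survive in the difference of their Gram matrices. *)
Lemma antilin_gram_diff (A B : 'M[C]_m) (gam := antilin B + 'i *: antilin A)
    (tau := antilin B - 'i *: antilin A) :
    conjm A = A -> conjm B = B -> A^T = - A -> B^T = - B ->
    A *m J = - (J *m A) -> B *m J = - (J *m B) ->
  [/\ gam^T = - gam, tau^T = - tau &
    gam *m gam^t* - tau *m tau^t* = - 'i *: (P *m (A *m B - B *m A) *m P^t*)].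
Proof.
move=> cA cB AT BT AJ BJ.
have alphaT := antilin_skew AT; have betaT := antilin_skew BT.
have gamT : gam^T = - gam.
  apply/matrixP => i j; have /matrixP/(_ i j) := alphaT; have /matrixP/(_ i j) := betaT.
  by rewrite !mxE => -> ->; rewrite mulrN opprD.
have tauT : tau^T = - tau.
  apply/matrixP => i j; have /matrixP/(_ i j) := alphaT; have /matrixP/(_ i j) := betaT.
  by rewrite !mxE => -> ->; rewrite mulrN opprD.
split=> //; have hA := antilinP AJ; have hB := antilinP BJ.
have cj (N : 'M[C]_m) (a : 'M[C]_n) : conjm N = N ->
    P *m N = a *m Q -> Q *m N = conjm a *m P.
  by move=> cN /(congr1 conjm); rewrite !map_mxM cN conjmK.
have hA' := cj _ _ cA hA; have hB' := cj _ _ cB hB.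
pose alpha := antilin A; pose beta := antilin B.
have W : P *m (A *m B - B *m A) *m P^t* = 2 *: (alpha *m conjm beta - beta *m conjm alpha).
  rewrite mulmxBr !mulmxA hA hB -[_ *m Q *m B]mulmxA -[_ *m Q *m A]mulmxA hA' hB'.
  by rewrite !mulmxA -mulmxBl -mulmxA PPt mul_mx_scalar.
have ct (K : 'M[C]_n) : K^T = - K -> K^t* = - conjm K by move=> ->; rewrite map_mxN.
rewrite W !ct // !mulmxN.
have -> : conjm gam = conjm beta - 'i *: conjm alpha.
  by rewrite /gam map_mxD conjm_scale_i.
have -> : conjm tau = conjm beta + 'i *: conjm alpha.
  by rewrite /tau map_mxB conjm_scale_i opprK.
by rewrite scaleNr -gram_diff_ring opprB opprK addrC.
Qed.

End AntilinearBlocks.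

(** * Comparison of Hermitian forms on a hyperplane *)

Section HermitianForms.
Local Open Scope sesquilinear_scope.
Variable R : rcfType.
Local Notation C := R[i].
Local Notation toC := (map_mx (real_complex R)).

Lemma conj_toC m p (M : 'M[R]_(m, p)) : map_mx Num.conj (toC M) = toC M.
Proof.
by apply/matrixP => i j; rewrite !mxE; apply/CrealP; rewrite complex_real.
Qed.

Lemma form_le m (E : 'M[R]_m) (e : R) (w : 'rV[C]_m) :
    (forall i j, `|E i j| <= e) ->
  `|(w *m toC E *m w^t*) 0 0| <= (e *+ m)%:C%C * (w *m w^t*) 0 0.
Proof.
move=> Ee; have wE : (w *m w^t*) 0 0 = \sum_i `|w 0 i| ^+ 2.
  by rewrite mxE; apply: eq_bigr => i _; rewrite !mxE normCK.
have : `|(w *m toC E *m w^t*) 0 0| <=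
    \sum_i \sum_j e%:C%C / 2%:R * (`|w 0 i| ^+ 2 + `|w 0 j| ^+ 2).
  rewrite mxE; apply: le_trans (ler_norm_sum _ _ _) _; apply: ler_sum => i _.
  rewrite !mxE mulr_suml; apply: le_trans (ler_norm_sum _ _ _) _.
  apply: ler_sum => j _; rewrite !normrM !mxE norm_conjC.
  have h0 : `|(E j i)%:C%C| <= e%:C%C.
    by rewrite normc_def /= expr0n /= addr0 sqrtr_sqr lecR.
  have a0 : 0 <= `|w 0 j| by [].
  have b0 : 0 <= `|w 0 i| by [].
  apply: (@le_trans _ _ (e%:C%C * (`|w 0 i| * `|w 0 j|))).
    by rewrite mulrAC mulrC (mulrC `|w 0 j|) ler_wpM2r ?mulr_ge0.
  rewrite -mulrA ler_wpM2l //; first by apply: le_trans h0.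
  rewrite ler_pdivlMl ?ltr0n // -subr_ge0.
  rewrite (_ : _ - _ = (`|w 0 i| - `|w 0 j|) ^+ 2); last first.
    by rewrite sqrrB addrAC mulr_natl.
  by rewrite real_exprn_even_ge0 // realB // normr_real.
move=> h; apply: le_trans h _; rewrite wE.
have -> : \sum_i \sum_j e%:C%C / 2%:R * (`|w 0 i| ^+ 2 + `|w 0 j| ^+ 2) =
   e%:C%C / 2%:R * (\sum_i \sum_(j < m) `|w 0 i| ^+ 2 + \sum_(i < m) \sum_j `|w 0 j| ^+ 2).
  rewrite -big_split mulr_sumr; apply: eq_bigr => i _.
  by rewrite -big_split mulr_sumr.
rewrite [X in _ * (_ + X)]exchange_big /= -mulr2n.
under eq_bigr do rewrite sumr_const card_ord.
rewrite sumrMnl rmorphMn /=; set c := e%:C%C; set s := \sum_i _.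
rewrite -(mulr_natr (s *+ m) 2) [_ * 2]mulrC mulrA divfK ?pnatr_eq0 //.
by rewrite mulrnAl mulrnAr.
Qed.

(** Each of the two rank-one terms has [x] as a factor on one side, where it meets [u *m P] or, [x]
    being real, the adjoint of [u *m P]. A single complex condition on [u] thus removes the whole
    wedge. *)
Lemma dual_form n m (P : 'M[C]_(n, m)) (M N : 'M[R]_m) (x y : 'cV[R]_m) (u : 'rV[C]_n) :
    u *m (P *m toC x) = 0 -> M = x *m y^T - y *m x^T + N ->
  u *m (P *m toC M *m P^t*) *m u^t* = (u *m P) *m toC N *m (u *m P)^t*.
Proof.
move=> ux ->; rewrite trmx_mul map_mxM !mulmxA -!(mulmxA (u *m P)).
have xu : toC x^T *m (P^t* *m u^t*) = 0.
  have := congr1 (fun M => M^t*) ux.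
  by rewrite !trmx_mul !map_mxM trmx0 map_mx0 map_trmx conj_toC -map_trmx mulmxA.
rewrite map_mxD map_mxB !map_mxM !mulmxDl !mulNmx -!mulmxA xu mulmx0 subr0.
by rewrite !mulmxDr [u *m _ in X in X + _]mulmxA !mulmxA -(mulmxA u) ux !mul0mx add0r.
Qed.

(** The last hypothesis compares [A, B] with [M] only after compression by [P], that is on
    [J]-linear parts, so that an antilinear term may be discarded beforehand. The angle enters
    through the trace: by [PtP] the compression of the traceless [M] has trace -i tr(J M), and tr(J
    M) is twice the angle plus tr(J E). *)
Lemma kahler_angle_le n m (J A B E : 'M[R]_m) (P : 'M[C]_(n, m)) (x y : 'cV[R]_m) (e : R)
    (M := x *m y^T - y *m x^T + E) :
    P *m toC J = 'i *: P -> P *m P^t* = 2%:M ->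
    P^t* *m P = 1%:M - 'i *: toC J -> J^T = - J ->
    A^T = - A -> B^T = - B -> E^T = - E ->
    A *m J = - (J *m A) -> B *m J = - (J *m B) ->
    (forall i j, `|E i j| <= e) -> 0 <= e ->
    P *m toC (A *m B - B *m A) *m P^t* = P *m toC M *m P^t* ->
  `|(y^T *m J *m x) 0 0| *+ 2 <= e *+ m *+ 2 *+ n + `|\tr (J *m E)|.
Proof.
move=> PJ PPt PtP JT AT BT ET AJ BJ Ee e0 comm.
have toCT (N : 'M[R]_m) : N^T = - N -> (toC N)^T = - toC N.
  by move=> NT; rewrite map_trmx NT map_mxN.
have toCJ (N : 'M[R]_m) : N *m J = - (J *m N) -> toC N *m toC J = - (toC J *m toC N).
  by move=> NJ; rewrite -!map_mxM NJ map_mxN.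
have [] := antilin_gram_diff (conj_toC J) PJ PPt PtP (conj_toC A) (conj_toC B)
  (toCT _ AT) (toCT _ BT) (toCJ _ AJ) (toCJ _ BJ).
set g := _ + _; set t := _ - _ => gT tT gt.
have {}gt : g *m g^t* - t *m t^t* = - 'i *: (P *m toC M *m P^t*).
  by rewrite gt -comm map_mxB !map_mxM.
pose q (K : 'M[C]_n) (u : 'rV[C]_n) := (u *m (K *m K^t*) *m u^t*) 0 0.
have qr K u : q K u \is Num.real.
  have -> : q K u = \sum_i `|(u *m K) 0 i| ^+ 2.
    rewrite /q !mulmxA -mulmxA mxE; apply: eq_bigr => i _.
    by rewrite -map_mxM -trmx_mul !mxE normCK.
  by apply: rpred_sum => i _; rewrite rpredX // normr_real.
have qd u : u *m (P *m toC x) = 0 ->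
    `|q g u - q t u| <= (e *+ m *+ 2)%:C%C * (u *m u^t*) 0 0.
  move=> ux; have -> : q g u - q t u = - 'i * ((u *m P) *m toC E *m (u *m P)^t*) 0 0.
    have : u *m (g *m g^t* - t *m t^t*) *m u^t* =
        - 'i *: ((u *m P) *m toC E *m (u *m P)^t*).
      by rewrite gt -(dual_form ux (erefl M)) -scalemxAr -scalemxAl.
    move=> /matrixP/(_ 0 0); rewrite mulmxBr mulmxBl [RHS]mxE => <-.
    by rewrite [RHS]mxE [X in _ = _ + X]mxE.
  rewrite normrM normrN normCi mul1r; apply: le_trans (form_le _ Ee) _.
  rewrite trmx_mul map_mxM mulmxA -(mulmxA u) PPt mul_mx_scalar -scalemxAl mxE.
  by rewrite mulrA mulr_natr -rmorphMn.
have d0 : 0 <= e *+ m *+ 2 by rewrite !mulrn_wge0.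
have le1 : \tr (g *m g^t*) <= \tr (t *m t^t*) + (e *+ m *+ 2 *+ n)%:C%C.
  apply: (skew_trace_le (v := P *m toC x)) => // u /qd h.
  rewrite -lerBlDl; apply: le_trans h; apply: real_ler_norm.
  exact: (realB (qr g u) (qr t u)).
have le2 : \tr (t *m t^t*) <= \tr (g *m g^t*) + (e *+ m *+ 2 *+ n)%:C%C.
  apply: (skew_trace_le (v := P *m toC x)) => // u /qd; rewrite distrC => h.
  rewrite -lerBlDl; apply: le_trans h; apply: real_ler_norm.
  exact: (realB (qr t u) (qr g u)).
have trE : \tr (g *m g^t*) - \tr (t *m t^t*) = (- \tr (J *m M))%:C%C.
  have MT : M^T = - M.
    by rewrite /M [LHS]linearD [X in X + _ = _]linearB /= !trmx_mul !trmxK ET opprD opprB.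
  have trM : \tr M = 0.
    have : \tr M = - \tr M by rewrite -{1}mxtrace_tr MT linearN.
    by move/eqP; rewrite -addr_eq0 -mulr2n mulrn_eq0 => /eqP.
  rewrite -linearB gt linearZ /= mxtrace_mulC mulmxA PtP mulmxBl mul1mx linearB.
  rewrite -scalemxAl linearZ /= -map_mxM !trace_map_mx trM rmorph0 sub0r.
  by rewrite mulrN mulNr opprK mulrA -expr2 sqrCi mulN1r rmorphN.
have trJM : \tr (J *m M) = (y^T *m J *m x) 0 0 *+ 2 + \tr (J *m E).
  rewrite /M mulmxDr mulmxBr linearD linearB /= !mulmxA.
  rewrite ![\tr (J *m _ *m _)]mxtrace_mulC !mulmxA !trace_mx11; congr (_ + _).
  have -> : x^T *m J *m y = - (y^T *m J *m x)^T.
    by rewrite !trmx_mul trmxK JT mulNmx mulmxN opprK mulmxA.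
  by rewrite !mxE opprK mulr2n.
have key : `|\tr (J *m M)| <= e *+ m *+ 2 *+ n.
  rewrite ler_norml; move: le1 le2; rewrite -!lerBlDl trE -(opprB (\tr (g *m _))) trE.
  by rewrite -rmorphN opprK !lecR lerNl => -> ->.
rewrite -normrMn; apply: le_trans (lerD key (lexx _)).
by rewrite -[X in `|X| <= _](addrK (\tr (J *m E))) -trJM ler_normB.
Qed.
End HermitianForms.

(** * The lower bound for an orthonormal pair *)

(** At [e = 0] the equations read a^2 = 1/4 and a^2 (4 p + 2 t) = r with p = t = 1/4 and r = 1/8, so
    a^2 = 1/12. The gap 1/6 leaves ample room for errors of a few multiples of 1/1000. *)
Lemma quadratic_clash (R : rcfType) (a e h k p q r t : R) :
    0 <= e -> e <= 1000^-1 ->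
    a ^+ 2 - a * h = 4^-1 - 2^-1 * k ->
    4 * a ^+ 2 * p = - (2 * a) * q + r - 2 * a ^+ 2 * t ->
    `|h| <= e -> `|k| <= 2 * e -> `|p - 4^-1| <= 3 * e -> `|t - 4^-1| <= 3 * e ->
    `|q| <= e -> `|r - 8^-1| <= 5 * e -> False.
Proof.
move=> e0 e1 I II he ke pe te qe re; set s := a ^+ 2 in I II.
have s0 : 0 <= s by rewrite sqr_ge0.
(* There is no a priori bound on [a]; trading it for [s] makes every constraint linear in [s], [e]
   and [s * e], and [se] disposes of the last. *)
have a1 : `|a| <= (1 + s) / 2.
  have := sqr_ge0 (`|a| - 1); rewrite sqrrB real_normK ?num_real // -/s; lra.
have se : s * e <= s * 1000^-1 by rewrite ler_wpM2l.
have ab z c : `|z| <= c -> `|a * z| <= (1 + s) / 2 * c.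
  by move=> zc; rewrite normrM ler_pM.
have sb z : `|z| <= 3 * e -> `|s * z| <= 3 * (s * e).
  by move=> ze; rewrite normrM ger0_norm // mulrCA ler_wpM2l.
move: (ab _ _ he) (ab _ _ qe) (sb _ pe) (sb _ te) ke re.
rewrite !ler_norml; lra.
Qed.

(** * Euclidean geometry of column vectors *)

Section Dot.
Variables (R : rcfType) (m : nat).
Implicit Types (u v w : 'cV[R]_m) (M : 'M[R]_m).

Definition dot u v : R := (u^T *m v) 0 0.
Definition vnorm u : R := Num.sqrt (dot u u).

Lemma dotE u v : dot u v = \sum_i u i 0 * v i 0.
Proof. by rewrite /dot mxE; apply: eq_bigr => i _; rewrite mxE. Qed.

Lemma dotC u v : dot u v = dot v u.
Proof. by rewrite !dotE; apply: eq_bigr => i _; rewrite mulrC. Qed.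

Lemma dotDl u v w : dot (u + v) w = dot u w + dot v w.
Proof. by rewrite /dot linearD mulmxDl mxE. Qed.

Lemma dotZl (c : R) u w : dot (c *: u) w = c * dot u w.
Proof. by rewrite /dot linearZ -scalemxAl mxE. Qed.

Lemma dotNl u w : dot (- u) w = - dot u w.
Proof. by rewrite -scaleN1r dotZl mulN1r. Qed.

Lemma dotDr u v w : dot w (u + v) = dot w u + dot w v.
Proof. by rewrite dotC dotDl !(dotC w). Qed.

Lemma dotZr (c : R) u w : dot w (c *: u) = c * dot w u.
Proof. by rewrite dotC dotZl (dotC w). Qed.

Lemma dotNr u w : dot w (- u) = - dot w u.
Proof. by rewrite dotC dotNl (dotC w). Qed.

Lemma dot0l u : dot 0 u = 0.
Proof. by rewrite -(scale0r u) dotZl mul0r. Qed.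

Lemma dot_trl M u v : dot (M *m u) v = dot u (M^T *m v).
Proof. by rewrite /dot trmx_mul mulmxA. Qed.

Lemma dot_skewl M u v : M^T = - M -> dot (M *m u) v = - dot u (M *m v).
Proof. by move=> MT; rewrite dot_trl MT mulNmx dotNr. Qed.

Lemma dot_skew0 M u : M^T = - M -> dot (M *m u) u = 0.
Proof. by move=> MT; have := dot_skewl u u MT; rewrite [dot u _]dotC; lra. Qed.

Lemma dot_ge0 u : 0 <= dot u u.
Proof. by rewrite dotE sumr_ge0 // => i _; rewrite -expr2 sqr_ge0. Qed.

Lemma dot_eq0 u : (dot u u == 0) = (u == 0).
Proof.
apply/eqP/eqP => [|->]; last by rewrite dot0l.
move/eqP; rewrite dotE psumr_eq0 => [/allP h|i _]; last by rewrite -expr2 sqr_ge0.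
apply/colP => i; have := h i (mem_index_enum _).
by rewrite /= -expr2 sqrf_eq0 mxE => /eqP.
Qed.

Lemma vnorm_ge0 u : 0 <= vnorm u. Proof. exact: sqrtr_ge0. Qed.

Lemma sqr_vnorm u : vnorm u ^+ 2 = dot u u.
Proof. by rewrite sqr_sqrtr // dot_ge0. Qed.

Lemma vnorm_eq0 u : (vnorm u == 0) = (u == 0).
Proof. by rewrite -dot_eq0 -sqr_vnorm sqrf_eq0. Qed.

Lemma dot_le u v : `|dot u v| <= vnorm u * vnorm v.
Proof.
have [->|v0] := eqVneq v 0.
  by rewrite dotC dot0l normr0 mulr_ge0 ?vnorm_ge0.
rewrite -ler_sqr ?nnegrE ?mulr_ge0 ?vnorm_ge0 // exprMn !sqr_vnorm real_normK ?num_real //.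
have vv : 0 < dot v v by rewrite lt_def dot_eq0 v0 dot_ge0.
have := dot_ge0 (dot v v *: u - dot u v *: v).
rewrite !(dotDl, dotDr, dotNl, dotNr, dotZl, dotZr) (dotC v u).
rewrite (_ : _ + _ = dot v v * (dot u u * dot v v - dot u v ^+ 2)); last by ring.
by rewrite pmulr_rge0 // subr_ge0.
Qed.

Lemma vnormD u v : vnorm (u + v) <= vnorm u + vnorm v.
Proof.
rewrite -ler_sqr ?nnegrE ?addr_ge0 ?vnorm_ge0 // sqrrD !sqr_vnorm.
rewrite !(dotDl, dotDr) (dotC v u).
have := le_trans (ler_norm _) (dot_le u v); lra.
Qed.

Lemma vnormZ (c : R) u : vnorm (c *: u) = `|c| * vnorm u.
Proof.
by rewrite /vnorm dotZl dotZr mulrA -expr2 sqrtrM ?sqr_ge0 // sqrtr_sqr.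
Qed.

Lemma vnormN u : vnorm (- u) = vnorm u.
Proof. by rewrite -scaleN1r vnormZ normrN1 mul1r. Qed.

Definition wedge u v : 'M[R]_m := u *m v^T - v *m u^T.

Lemma wedgeE u v w : wedge u v *m w = dot v w *: u - dot u w *: v.
Proof.
rewrite /wedge mulmxBl -!mulmxA.
have sc (s t : 'cV[R]_m) : s *m (t^T *m w) = dot t w *: s.
  by rewrite [t^T *m w]mx11_scalar mul_mx_scalar.
by rewrite !sc.
Qed.

Section ComplexStructure.
Variable J : 'M[R]_m.
Hypotheses (JT : J^T = - J) (JJ : J *m J = - 1%:M).

Lemma dot_J u v : dot (J *m u) (J *m v) = dot u v.
Proof. by rewrite dot_trl JT mulNmx mulmxA JJ mulNmx mul1mx opprK. Qed.

Lemma vnorm_J u : vnorm (J *m u) = vnorm u.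
Proof. by rewrite /vnorm dot_J. Qed.

(* With [theta := dot y (J x)] close to 0, [0 = dot (A y) (J y)] forces
   [a ^+ 2] to be close to 1/4, whereas [dot (A (B y)) (J (B y)) = 0] forces it
   to be close to 1/12. *)
Lemma bracket_lower_bound (A B : 'M[R]_m) (a e : R) (x y : 'cV[R]_m)
    (E := (a *: J + A) *m B - B *m (a *: J + A) - wedge x y)
    (eta := (a *: J + A) *m y - B *m x) :
    A^T = - A -> B^T = - B -> A *m J = - (J *m A) -> B *m J = - (J *m B) ->
    dot x x = 1 -> dot y y = 1 -> dot x y = 0 ->
    (forall v, vnorm (E *m v) <= e * vnorm v) -> vnorm eta <= e ->
    `|dot y (J *m x)| <= e ->
  1000^-1 < e.
Proof.
move=> AT BT AJ BJ xx yy xy Ee etae the; rewrite ltNge; apply/negP => e_le.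
have nx : vnorm x = 1 by rewrite /vnorm xx sqrtr1.
have ny : vnorm y = 1 by rewrite /vnorm yy sqrtr1.
set th := dot y (J *m x) in the.
have e0 : 0 <= e by apply: le_trans the.
have xJy : dot x (J *m y) = - th.
  by rewrite /th dotC (dot_skewl _ _ JT).
have xJx : dot x (J *m x) = 0 by rewrite dotC dot_skew0.
have yJy : dot y (J *m y) = 0 by rewrite dotC dot_skew0.
(* [S] = [a J, B] is antilinear and [L] = [A, B] is linear with respect to [J]. The map sending M to
   J M J fixes the first and negates the second, so each is half the sum or half the difference of
   [E + wedge x y] and its image. *)
pose S := (2 * a) *: (J *m B).
pose L := A *m B - B *m A.
have EL : E = S + L - wedge x y.
  rewrite /E /S /L mulmxDl mulmxDr -scalemxAl -scalemxAr BJ scalerN.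
  by apply/matrixP => i j; rewrite !mxE; ring.
have JS : J *m S *m J = S.
  rewrite /S -scalemxAr -scalemxAl; congr (_ *: _).
  by rewrite -!mulmxA BJ !mulmxN !mulmxA JJ !mulNmx opprK mul1mx.
have JL : J *m L *m J = - L.
  have h (P Q : 'M[R]_m) : P *m J = - (J *m P) -> Q *m J = - (J *m Q) ->
      J *m (P *m Q) *m J = - (P *m Q).
    move=> PJ QJ; rewrite -!mulmxA QJ mulmxN (mulmxA P) PJ mulNmx opprK !mulmxA.
    by rewrite JJ mulNmx mul1mx mulNmx.
  by rewrite /L mulmxBr mulmxBl !h // opprD.
have JE : J *m E *m J = S - L - J *m wedge x y *m J.
  by rewrite EL mulmxBr mulmxDr mulmxBl mulmxDl JS JL.
clearbody E.
have WJ v : J *m wedge x y *m J *m v =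
    dot y (J *m v) *: (J *m x) - dot x (J *m v) *: (J *m y).
  by rewrite -!mulmxA wedgeE mulmxBr -!scalemxAr.
have SE v : S *m v = 2^-1 *: (wedge x y *m v + J *m wedge x y *m J *m v
    + (E *m v + J *m (E *m (J *m v)))).
  have -> : E *m v + J *m (E *m (J *m v)) = (E + J *m E *m J) *m v.
    by rewrite mulmxDl !mulmxA.
  rewrite JE EL -!mulmxDl scalemxAl; congr (_ *m _).
  by apply/matrixP => i j; rewrite !mxE; field.
have LE v : L *m v = 2^-1 *: (wedge x y *m v - J *m wedge x y *m J *m v
    + (E *m v - J *m (E *m (J *m v)))).
  have -> : E *m v - J *m (E *m (J *m v)) = (E - J *m E *m J) *m v.
    by rewrite mulmxBl !mulmxA.
  rewrite JE EL -mulmxBl -mulmxDl scalemxAl.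
  by congr (_ *m _); apply/matrixP => i j; rewrite !mxE; field.
have nE1 v : vnorm (2^-1 *: (E *m v + J *m (E *m (J *m v)))) <= e * vnorm v.
  rewrite vnormZ ger0_norm ?invr_ge0 //; have := vnormD (E *m v) (J *m (E *m (J *m v))).
  rewrite vnorm_J; have := Ee v; have := Ee (J *m v); rewrite vnorm_J; lra.
have nE2 v : vnorm (2^-1 *: (E *m v - J *m (E *m (J *m v)))) <= e * vnorm v.
  rewrite vnormZ ger0_norm ?invr_ge0 //; have := vnormD (E *m v) (- (J *m (E *m (J *m v)))).
  rewrite vnormN vnorm_J; have := Ee v; have := Ee (J *m v); rewrite vnorm_J; lra.
have nth v : vnorm v = 1 -> vnorm ((th / 2) *: (J *m v)) <= e.
  move=> v1; rewrite vnormZ vnorm_J v1 mulr1 normrM [`|2^-1|]ger0_norm ?invr_ge0 //.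
  have := normr_ge0 th; lra.
(* To leading order S y = x/2, S x = -y/2 and L y = x/2. The transformed wedge contributes only
   multiples of [th] at [x] and [y], and [the] makes these part of the error. *)
pose e1 := S *m y - 2^-1 *: x; pose e2 := S *m x + 2^-1 *: y.
pose e3 := L *m y - 2^-1 *: x.
have ne1 : vnorm e1 <= 2 * e.
  have -> : e1 = (th / 2) *: (J *m y) + 2^-1 *: (E *m y + J *m (E *m (J *m y))).
    rewrite /e1 SE WJ wedgeE yy xy yJy xJy.
    by apply/matrixP => i j; rewrite !mxE; field.
  have := vnormD ((th / 2) *: (J *m y)) (2^-1 *: (E *m y + J *m (E *m (J *m y)))).
  have := nE1 y; have := nth _ ny; rewrite ny; lra.
have ne2 : vnorm e2 <= 2 * e.
  have -> : e2 = (th / 2) *: (J *m x) + 2^-1 *: (E *m x + J *m (E *m (J *m x))).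
    rewrite /e2 SE WJ wedgeE (dotC y x) xy xx -/th xJx.
    by apply/matrixP => i j; rewrite !mxE; field.
  have := vnormD ((th / 2) *: (J *m x)) (2^-1 *: (E *m x + J *m (E *m (J *m x)))).
  have := nE1 x; have := nth _ nx; rewrite nx; lra.
have ne3 : vnorm e3 <= 2 * e.
  have -> : e3 = - ((th / 2) *: (J *m y)) + 2^-1 *: (E *m y - J *m (E *m (J *m y))).
    rewrite /e3 LE WJ wedgeE yy xy yJy xJy.
    by apply/matrixP => i j; rewrite !mxE; field.
  have := vnormD (- ((th / 2) *: (J *m y))) (2^-1 *: (E *m y - J *m (E *m (J *m y)))).
  rewrite vnormN; have := nE2 y; have := nth _ ny; rewrite ny; lra.
(* [B] has no bound of its own, but [S] does: the wedge and its transform have operator norm at most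
   2 each, so their half sum has at most 2, and the remaining error is at most [e <= 1]. *)
have nS v : vnorm (S *m v) <= 3 * vnorm v.
  have d1 w z : vnorm w = 1 -> vnorm z = 1 -> vnorm (dot w v *: z) <= vnorm v.
    move=> w1 z1; rewrite vnormZ z1 mulr1; have := dot_le w v; rewrite w1; lra.
  have d2 w z : vnorm w = 1 -> vnorm z = 1 -> vnorm (dot w (J *m v) *: z) <= vnorm v.
    move=> w1 z1; rewrite vnormZ z1 mulr1; have := dot_le w (J *m v); rewrite w1 vnorm_J; lra.
  rewrite SE WJ wedgeE scalerDr; apply: le_trans (vnormD _ _) _.
  have nJx : vnorm (J *m x) = 1 by rewrite vnorm_J.
  have nJy : vnorm (J *m y) = 1 by rewrite vnorm_J.
  set t1 := dot y v *: x - _; set t2 := dot y (J *m v) *: _ - _.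
  rewrite [X in X + _]vnormZ [`|2^-1|]ger0_norm ?invr_ge0 //.
  have := nE1 v; have := vnormD t1 t2.
  have := vnormD (dot y v *: x) (- (dot x v *: y)).
  have := vnormD (dot y (J *m v) *: (J *m x)) (- (dot x (J *m v) *: (J *m y))).
  rewrite -/t1 -/t2 !vnormN.
  have := d1 _ _ ny nx; have := d1 _ _ nx ny; have := d2 _ _ ny nJx; have := d2 _ _ nx nJy.
  have : e * vnorm v <= vnorm v by rewrite ler_piMl ?vnorm_ge0 //; lra.
  lra.
pose e4 := S *m (S *m y) + 4^-1 *: y.
have ne4 : vnorm e4 <= 7 * e.
  have -> : e4 = 2^-1 *: e2 + S *m e1.
    rewrite /e4 -[in LHS](subrK (2^-1 *: x) (S *m y)) -/e1 mulmxDr -scalemxAr.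
    rewrite -[in LHS](addrK (2^-1 *: y) (S *m x)) -/e2.
    by apply/matrixP => i j; rewrite !mxE; field.
  apply: le_trans (vnormD _ _) _; rewrite vnormZ ger0_norm ?invr_ge0 //.
  have := nS e1; lra.
have ST : S^T = - S.
  by rewrite /S linearZ /= trmx_mul BT JT mulmxN mulNmx opprK BJ scalerN.
have SyE : S *m y = 2^-1 *: x + e1 by rewrite addrC subrK.
have SxE : S *m x = - (2^-1 *: y) + e2 by rewrite addrC addrK.
have LyE : L *m y = 2^-1 *: x + e3 by rewrite addrC subrK.
have SSyE : S *m (S *m y) = - (4^-1 *: y) + e4 by rewrite addrC addrK.
clearbody e1 e2 e3 e4.
have JSx : J *m (S *m x) = - ((2 * a) *: (B *m x)).
  rewrite /S -scalemxAl -scalemxAr !mulmxA JJ mulNmx mul1mx mulNmx.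
  by rewrite scalerN.
have Ay : A *m y = eta + B *m x - a *: (J *m y).
  rewrite /eta mulmxDl -scalemxAl; apply/matrixP => i j; rewrite !mxE; ring.
clearbody eta.
have skJ M : M^T = - M -> M *m J = - (J *m M) -> (J *m M)^T = - (J *m M).
  by move=> MT MJ; rewrite trmx_mul MT JT mulmxN mulNmx opprK MJ.
(* [J *m A] is skew because [A] anticommutes with [J]. Both equations for [a] are instances of this
   identity, at [y] and at [B *m y]. *)
have AJ0 v : dot (A *m v) (J *m v) = 0.
  by rewrite dotC (dot_skewl _ _ JT) mulmxA dotC (dot_skew0 _ (skJ _ AT AJ)) oppr0.
have two : 2 * a * dot (B *m x) (J *m y) = - dot (S *m x) y.
  have := dot_J (S *m x) y; rewrite JSx dotNl dotZl; lra.
have I : a ^+ 2 - a * dot eta (J *m y) = 4^-1 - 2^-1 * dot e2 y.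
  have := AJ0 y; rewrite Ay !(dotDl, dotNl, dotZl) dot_J yy => h.
  have : 2 * a * (dot eta (J *m y) + dot (B *m x) (J *m y) - a * 1) = 0 by rewrite h mulr0.
  rewrite mulrDr mulrDr two SxE dotDl dotNl dotZl yy => {}h; nra.
(* The factor 4 a^2 turns [B *m (B *m y)] into [S *m (S *m y)]. Only vectors already estimated
   remain, and there is no division by [a], which might be 0. *)
have II : 4 * a ^+ 2 * dot (L *m y) (S *m y) =
    - (2 * a) * dot eta (J *m (S *m (S *m y))) + dot (S *m x) (S *m (S *m y))
    - 2 * a ^+ 2 * dot (S *m y) (S *m y).
  have SSy : S *m (S *m y) = (4 * a ^+ 2) *: (B *m (B *m y)).
    rewrite /S -!scalemxAl -!scalemxAr scalerA -!mulmxA.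
    rewrite (mulmxA B J) BJ mulNmx mulmxN !mulmxA JJ !mulNmx mul1mx opprK.
    by congr (_ *: _); ring.
  have h1 : dot (L *m y) (S *m y) = - (2 * a) * dot (A *m y) (J *m (B *m (B *m y))).
    rewrite /L /S -scalemxAl dotZr mulmxBl dotDl dotNl -!mulmxA AJ0 sub0r.
    rewrite (dot_skewl _ _ BT) opprK.
    by rewrite (mulmxA B J) BJ mulNmx dotNr -!mulmxA; ring.
  have h2 : 4 * a ^+ 2 * dot (L *m y) (S *m y) =
      - (2 * a) * dot (A *m y) (J *m (S *m (S *m y))).
    by rewrite h1 SSy -scalemxAr dotZr; ring.
  rewrite h2 Ay !(dotDl, dotNl, dotZl) dot_J.
  have := dot_J (S *m x) (S *m (S *m y)); rewrite JSx dotNl dotZl.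
  by rewrite (dot_skewl y (S *m y) ST); lra.
have dle u v c d : vnorm u <= c -> vnorm v <= d -> `|dot u v| <= c * d.
  by move=> uc vd; apply: le_trans (dot_le _ _) (ler_pM _ _ _ _); rewrite ?vnorm_ge0.
have n7 : e * e <= e * 1000^-1 by rewrite ler_wpM2l.
have b1 := dle _ _ _ _ etae (lexx (vnorm (J *m y))).
have b2 := dle _ _ _ _ ne2 (lexx (vnorm y)).
have b3 := dle _ _ _ _ ne3 ne1.
have b4 := dle _ _ _ _ ne3 (lexx (vnorm x)).
have b5 := dle _ _ _ _ ne1 (lexx (vnorm x)).
have b6 := dle _ _ _ _ ne1 ne1.
have b7 := dle _ _ _ _ ne4 (lexx (vnorm y)).
have b8 := dle _ _ _ _ ne2 ne4.
have nJS : vnorm (J *m (S *m (S *m y))) <= 1.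
  rewrite vnorm_J SSyE; apply: le_trans (vnormD _ _) _.
  rewrite vnormN vnormZ ny ger0_norm ?invr_ge0 //; lra.
have b9 := dle _ _ _ _ etae nJS.
rewrite vnorm_J ny in b1; rewrite ny in b2 b7; rewrite nx in b4 b5.
have c1 : `|dot (L *m y) (S *m y) - 4^-1| <= 3 * e.
  rewrite LyE SyE !(dotDl, dotDr, dotZl, dotZr) xx (dotC x).
  move: b3 b4 b5; rewrite !ler_norml; lra.
have c2 : `|dot (S *m y) (S *m y) - 4^-1| <= 3 * e.
  rewrite SyE !(dotDl, dotDr, dotZl, dotZr) xx (dotC x).
  move: b6 b5; rewrite !ler_norml; lra.
have c3 : `|dot (S *m x) (S *m (S *m y)) - 8^-1| <= 5 * e.
  rewrite SSyE SxE !(dotDl, dotDr, dotNl, dotNr, dotZl, dotZr) yy (dotC y).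
  move: b2 b7 b8; rewrite !ler_norml; lra.
apply: (quadratic_clash e0 e_le I II) => //; first by rewrite mulr1 in b1.
- by rewrite mulr1 in b2.
- by rewrite mulr1 in b9.
Qed.
End ComplexStructure.
End Dot.

(** * The standard complex structure *)

Section Tensor.
Variable T : comPzRingType.

Lemma tens11 m p : 1%:M *t 1%:M = 1%:M :> 'M[T]_(m * p).
Proof.
apply/matrixP => i j; case: (mxtens_indexP i) => i0 i1; case: (mxtens_indexP j) => j0 j1.
rewrite tensmxE !mxE (can_eq (@mxtens_indexK m p)) xpair_eqE.
by case: eqP => _; case: eqP => _; rewrite /= ?(mul0r, mulr0, mul1r).
Qed.

Lemma tensmxDr m p q r (A : 'M[T]_(m, p)) (B D : 'M[T]_(q, r)) :
  A *t (B + D) = A *t B + A *t D.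
Proof. by apply/matrixP => i j; rewrite !mxE mulrDr. Qed.

Lemma tensmxZr m p q r (c : T) (A : 'M[T]_(m, p)) (B : 'M[T]_(q, r)) :
  A *t (c *: B) = c *: (A *t B).
Proof. by apply/matrixP => i j; rewrite !mxE mulrCA. Qed.

Lemma tensmxDl m p q r (A B : 'M[T]_(m, p)) (D : 'M[T]_(q, r)) :
  (A + B) *t D = A *t D + B *t D.
Proof. by apply/matrixP => i j; rewrite !mxE mulrDl. Qed.

Lemma tensmxNl m p q r (A : 'M[T]_(m, p)) (D : 'M[T]_(q, r)) : (- A) *t D = - (A *t D).
Proof. by apply/matrixP => i j; rewrite !mxE mulNr. Qed.

Lemma tensmxNr m p q r (A : 'M[T]_(m, p)) (B : 'M[T]_(q, r)) : A *t (- B) = - (A *t B).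
Proof. by apply/matrixP => i j; rewrite !mxE mulrN. Qed.

End Tensor.

Section StandardComplexStructure.
Local Open Scope sesquilinear_scope.
Variables (R : realType) (n : nat).
Local Notation C := R[i].
Local Notation toC := (map_mx (real_complex R)).

Definition stdJ : 'M[R]_(n * 2) := 1%:M *t rot90 R.

Lemma rot90_tr : (rot90 R)^T = - rot90 R.
Proof.
by apply/matrixP => i j; rewrite !mxE; case: i j => [[|[|//]] ?] [[|[|//]] ?] /=; rewrite ?oppr0 ?opprK.
Qed.

Lemma rot90_sqr : rot90 R *m rot90 R = - 1%:M.
Proof.
apply/matrixP => i j; rewrite !mxE !big_ord_recl big_ord0 !mxE.
by case: i j => [[|[|//]] ?] [[|[|//]] ?] /=; rewrite ?(mulr0, mul0r, addr0, add0r, mulr1, mul1r, oppr0).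
Qed.

Lemma stdJ_tr : stdJ^T = - stdJ.
Proof.
by rewrite trmx_tens trmx1 rot90_tr -scaleN1r tensmxZr scaleN1r.
Qed.

Lemma stdJ_sqr : stdJ *m stdJ = - 1%:M.
Proof.
by rewrite tensmx_mul mul1mx rot90_sqr -scaleN1r tensmxZr tens11 scaleN1r.
Qed.

Lemma stdJ_norm_le1 i j : `|stdJ i j| <= 1.
Proof.
case: (mxtens_indexP i) => i0 i1; case: (mxtens_indexP j) => j0 j1.
rewrite tensmxE normrM mulr_ile1 // mxE.
  by case: eqP; rewrite ?normr0 ?normr1.
by do 2?case: ifP; rewrite ?normrN ?normr0 ?normr1.
Qed.

Definition crow : 'rV[C]_2 := \row_j (if j == 0 then 1 else 'i).
(** The identification z_k = x_(2k) + i x_(2k+1) of R^(2n) with C^n, as a complex matrix; [n * 1] is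
    the number of rows that the tensor product produces. *)
Definition cproj : 'M[C]_(n * 1, n * 2) := 1%:M *t crow.

Lemma cproj_J : cproj *m toC stdJ = 'i *: cproj.
Proof.
rewrite map_mxT tensmx_mul map_mx1 mul1mx -tensmxZr; congr (_ *t _).
apply/matrixP => i j; rewrite !mxE !big_ord_recl big_ord0 !mxE /=.
case: j => [[|[|//]] ?] /=; rewrite ?rmorph0 ?rmorph1 ?rmorphN ?rmorph1.
  by rewrite mulr0 add0r addr0.
by rewrite mulr0 addr0 mul1r -expr2 sqrCi addr0.
Qed.

Lemma cproj_unitary : cproj *m cproj^t* = 2%:M.
Proof.
rewrite trmx_tens map_mxT tensmx_mul trmx1 map_mx1 mul1mx.
have -> : crow *m crow^t* = 2 *: 1%:M.
  apply/matrixP => i j; rewrite !ord1 !mxE !big_ord_recl big_ord0 !mxE /=.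
  by rewrite rmorph1 conjCi mulr1 mulrN -expr2 sqrCi opprK addr0 mulr1.
by rewrite tensmxZr tens11 scalemx1.
Qed.

Lemma cproj_gram : cproj^t* *m cproj = 1%:M - 'i *: toC stdJ.
Proof.
rewrite trmx_tens map_mxT tensmx_mul trmx1 map_mx1 mul1mx map_mxT map_mx1.
rewrite -tensmxZr -tens11 -scaleN1r -tensmxZr -tensmxDr; congr (_ *t _).
apply/matrixP => i j; rewrite !mxE big_ord1 !mxE.
case: i j => [[|[|//]] ?] [[|[|//]] ?] /=;
  rewrite ?(rmorph0, rmorph1, rmorphN, rmorph1, conjCi, mulr0, mul1r, mulr1, addr0, add0r).
- by [].
- rewrite mulN1r mulrN mulr1. by rewrite opprK.
- by rewrite mulN1r.
- by rewrite mulNr -expr2 sqrCi opprK.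
Qed.

End StandardComplexStructure.

(** * Bracket bounds for block matrices *)

Section EntryBounds.
Variables (R : rcfType) (m : nat).

Lemma entry_le_vnorm (u : 'cV[R]_m) i : `|u i 0| <= vnorm u.
Proof.
rewrite -sqrtr_sqr ler_sqrt ?dot_ge0 // dotE (bigD1 i) //= -expr2 lerDl.
by rewrite sumr_ge0 // => j _; rewrite -expr2 sqr_ge0.
Qed.

Lemma vnorm_le_entries (u : 'cV[R]_m) (c : R) :
  0 <= c -> (forall i, `|u i 0| <= c) -> vnorm u <= c *+ m.
Proof.
move=> c0 uc; rewrite -ler_sqr ?nnegrE ?vnorm_ge0 ?mulrn_wge0 // sqr_vnorm dotE.
apply: (@le_trans _ _ (\sum_(i < m) c ^+ 2)).
  apply: ler_sum => i _; rewrite -expr2 -[u i 0 ^+ 2]real_normK ?num_real //.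
  by rewrite ler_sqr ?nnegrE.
rewrite sumr_const card_ord exprMn_n -(mulr_natr _ m) -(mulr_natr _ (m ^ 2)%N).
by rewrite ler_wpM2l ?sqr_ge0 // ler_nat; case: (m) => // k; rewrite leq_pmull.
Qed.

Lemma mulmx_vnorm_le (E : 'M[R]_m) (c : R) (v : 'cV[R]_m) :
  0 <= c -> (forall i j, `|E i j| <= c) -> vnorm (E *m v) <= c *+ m *+ m * vnorm v.
Proof.
move=> c0 Ec; rewrite mulrnAl; apply: vnorm_le_entries.
  by rewrite mulr_ge0 ?vnorm_ge0 ?mulrn_wge0.
move=> i; have -> : (E *m v) i 0 = dot (row i E)^T v.
  by rewrite dotE mxE; apply: eq_bigr => j _; rewrite !mxE.
apply: le_trans (dot_le _ _) _; rewrite ler_wpM2r ?vnorm_ge0 //.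
by apply: vnorm_le_entries => // j; rewrite !mxE.
Qed.

Lemma trace_mul_le (J E : 'M[R]_m) (c : R) :
    0 <= c -> (forall i j, `|J i j| <= 1) -> (forall i j, `|E i j| <= c) ->
  `|\tr (J *m E)| <= c *+ m *+ m.
Proof.
move=> c0 J1 Ec; apply: le_trans (ler_norm_sum _ _ _) _.
rewrite -[X in _ *+ X]card_ord -sumr_const ler_sum // => i _; rewrite mxE.
apply: le_trans (ler_norm_sum _ _ _) _; rewrite -[X in _ *+ X]card_ord -sumr_const.
by apply: ler_sum => j _; rewrite normrM -[c]mul1r ler_pM.
Qed.

Lemma wedge_entry_le (x y : 'cV[R]_m) i j :
  `|wedge x y i j| <= 2 * (vnorm x * vnorm y).
Proof.
rewrite !mxE !big_ord1 !mxE; apply: le_trans (ler_normB _ _) _.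
rewrite !normrM mulrDl !mul1r lerD //; last rewrite mulrC;
  by rewrite ler_pM // entry_le_vnorm.
Qed.

End EntryBounds.

Section LieBlocks.
Variables (R : realType) (m : nat).
Implicit Types (D : 'M[R]_m) (x y : 'cV[R]_m).

(** For skew [D] this is the general element of so(m + 1), with [D] its component in k and [x] its
    component in s. *)
Definition so_block D x : 'M[R]_(m + 1) := block_mx D x (- x^T) 0.

Lemma so_blockZ c D x : c *: so_block D x = so_block (c *: D) (c *: x).
Proof. by rewrite /so_block scale_block_mx scaler0 scalerN [(c *: x)^T]linearZ. Qed.

Lemma so_blockD D1 D2 x y :
  so_block D1 x + so_block D2 y = so_block (D1 + D2) (x + y).
Proof. by rewrite /so_block add_block_mx addr0 [(x + y)^T]linearD opprD. Qed.

Lemma lie_bracket_so_block D1 D2 x y :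
  lie_bracket (so_block D1 x) (so_block D2 y) =
    block_mx (lie_bracket D1 D2 - wedge x y) (D1 *m y - D2 *m x)
      (- x^T *m D2 + y^T *m D1) (- x^T *m y + y^T *m x).
Proof.
rewrite /lie_bracket /so_block !mulmx_block opp_block_mx add_block_mx.
rewrite !mulmx0 !mul0mx !addr0 !mulNmx !mulmxN opprK /wedge; congr block_mx;
  by apply/matrixP => i j; rewrite !mxE; ring.
Qed.

Lemma lie_bracket_comb (X Y : 'M[R]_m) (p q r s : R) :
  lie_bracket (p *: X + q *: Y) (r *: X + s *: Y) = (p * s - q * r) *: lie_bracket X Y.
Proof.
rewrite /lie_bracket !mulmxDl !mulmxDr -!scalemxAl -!scalemxAr !scalerA.
by apply/matrixP => i j; rewrite !mxE; ring.
Qed.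

Lemma wedge_comb x y (p q r s : R) :
  wedge (p *: x + q *: y) (r *: x + s *: y) = (p * s - q * r) *: wedge x y.
Proof. by apply/matrixP => i j; rewrite !mxE !big_ord1 !mxE; ring. Qed.

End LieBlocks.

Section WedgeBound.
Local Open Scope sesquilinear_scope.
Variables (R : realType) (n : nat).
Local Notation m := (n * 2)%N.
Local Notation J := (stdJ R n).
Implicit Types (A B D : 'M[R]_m) (x y : 'cV[R]_m).

(** In P D J P^*, letting [J] act on the adjoint of [P] gives the factor i, while moving it across
    [D] onto [P] gives -i. *)
Lemma cproj_antilin0 D : D *m J = - (J *m D) ->
  cproj R n *m map_mx (real_complex R) D *m (cproj R n)^t* = 0.
Proof.
move=> DJ; set P := cproj R n; set c := map_mx (real_complex R).
have JP : c J *m P^t* = 'i *: P^t*.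
  have := congr1 (fun M => M^t*) (cproj_J R n).
  rewrite trmx_mul map_mxM map_trmx conj_toC -map_trmx stdJ_tr map_mxN mulNmx.
  move/eqP; rewrite eqr_oppLR => /eqP ->.
  by apply/matrixP => i j; rewrite !mxE rmorphM /= conjCi mulNr opprK.
have h : P *m c D *m P^t* = - (P *m c D *m P^t*).
  have : P *m (c D *m c J) *m P^t* = 'i *: (P *m c D *m P^t*).
    by rewrite -!mulmxA JP -!scalemxAr.
  rewrite -map_mxM DJ map_mxN map_mxM mulmxN mulNmx !mulmxA cproj_J -!scalemxAl.
  by rewrite -scalerN => /(scalerI (neq0Ci _)).
apply/matrixP => i j; rewrite [RHS]mxE; have /matrixP/(_ i j)/eqP := h.
by rewrite [X in _ == X]mxE -addr_eq0 -mulr2n mulrn_eq0 => /eqP.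
Qed.

(** These matrices form the orthogonal complement of u(n) in so(2n). *)
Definition antilinear_skew A := A^T = - A /\ A *m J = - (J *m A).

Lemma antilinear_skewZ c A : antilinear_skew A -> antilinear_skew (c *: A).
Proof.
by move=> [AT AJ]; split; rewrite ?linearZ /= ?AT ?scalerN // -scalemxAl AJ scalerN scalemxAr.
Qed.

Lemma antilinear_skewD A B :
  antilinear_skew A -> antilinear_skew B -> antilinear_skew (A + B).
Proof.
move=> [AT AJ] [BT BJ]; split; first by rewrite linearD /= AT BT opprD.
by rewrite mulmxDl mulmxDr AJ BJ opprD.
Qed.

(** By [kahler_angle_le] and [trace_mul_le], twice the angle is at most e (m * 2n + m^2) = 2 m^2 e.
    The same m^2 e bounds the operator norm of an m x m matrix with entries at most [e]. *)
Definition angle_const : R := (m * m)%:R + 1.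

Lemma orthonormal_bound a A B x y e :
    antilinear_skew A -> antilinear_skew B ->
    dot x x = 1 -> dot y y = 1 -> dot x y = 0 -> 0 <= e ->
    (forall i j, `|lie_bracket (so_block (a *: J + A) x) (so_block B y) i j| <= e) ->
  1000^-1 < angle_const * e.
Proof.
move=> [AT AJ] [BT BJ] xx yy xy e0; rewrite lie_bracket_so_block => le.
have Ee i j : `|(lie_bracket (a *: J + A) B - wedge x y) i j| <= e.
  by have := le (lshift 1 i) (lshift 1 j); rewrite block_mxEul.
have etae i : `|((a *: J + A) *m y - B *m x) i 0| <= e.
  by have := le (lshift 1 i) (rshift m 0); rewrite block_mxEur.
have mm : (e *+ m *+ m = e * (m * m)%:R)%R by rewrite -mulrnA mulr_natr.
have le1 : e * (m * m)%:R <= angle_const * e by rewrite mulrC /angle_const mulrDl lerDl mul1r.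
apply: (bracket_lower_bound (stdJ_tr R n) (stdJ_sqr R n) AT BT AJ BJ xx yy xy).
- move=> v; apply: le_trans (mulmx_vnorm_le _ e0 Ee) _.
  by rewrite mm ler_wpM2r ?vnorm_ge0.
- apply: le_trans (vnorm_le_entries e0 etae) _; apply: le_trans le1.
  rewrite -[e *+ m]mulr_natr ler_wpM2l // ler_nat.
  by case: (m) => // k; rewrite leq_pmulr.
set E := lie_bracket _ B - _ in Ee.
have ET : E^T = - E.
  have JAT : (a *: J + A)^T = - (a *: J + A).
    by rewrite linearD linearZ /= stdJ_tr AT scalerN opprD.
  have WT : (wedge x y)^T = - wedge x y.
    by rewrite /wedge linearB /= !trmx_mul !trmxK opprB.
  rewrite /E [LHS]linearB /= WT /lie_bracket [X in X + _ = _]linearB /= !trmx_mul JAT BT.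
  by rewrite !mulNmx !mulmxN !opprK opprB opprB addrC.
(* The two sides differ by the antilinear term 2 a J B, which the compression by [cproj]
   annihilates. *)
have comm : cproj R n *m map_mx (real_complex R) (A *m B - B *m A) *m (cproj R n)^t* =
    cproj R n *m map_mx (real_complex R) (x *m y^T - y *m x^T + E) *m (cproj R n)^t*.
  have -> : x *m y^T - y *m x^T + E = (A *m B - B *m A) + (2 * a) *: (J *m B).
    rewrite /E /lie_bracket /wedge mulmxDl mulmxDr -scalemxAl -scalemxAr BJ scalerN.
    by apply/matrixP => i j; rewrite !mxE; ring.
  rewrite [in RHS]map_mxD mulmxDr mulmxDl [X in _ = _ + X]cproj_antilin0 ?addr0 //.
  by rewrite -scalemxAl -!scalemxAr -mulmxA BJ -scalerN mulmxN.
have := kahler_angle_le (cproj_J R n) (cproj_unitary R n) (cproj_gram R n)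
  (stdJ_tr R n) AT BT ET AJ BJ Ee e0 comm.
have := trace_mul_le e0 (@stdJ_norm_le1 R n) Ee.
rewrite -!mulrnA -[(y^T *m _ *m _)]mulmxA -/(dot _ _) muln1.
have -> : (m * (2 * n) = m * m)%N by rewrite (mulnC 2).
rewrite -(mulr_natr e) -(mulr_natr `|dot _ _|) => tr ang.
apply: le_trans le1; lra.
Qed.

(** Gram-Schmidt replaces X by X - c Y, which keeps the shape since Y has no [J]-component.
    Normalising divides the bracket by |z| |y|, so [orthonormal_bound] yields |z| |y| < 1000 *
    angle_const * e. Entries of the wedge are at most twice |z| |y|, hence 2000. *)
Lemma wedge_bound_antilinear a A B x y e :
    antilinear_skew A -> antilinear_skew B -> 0 <= e ->
    (forall i j, `|lie_bracket (so_block (a *: J + A) x) (so_block B y) i j| <= e) ->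
  forall i j, `|wedge x y i j| <= 2000 * angle_const * e.
Proof.
move=> As Bs e0 le i j.
have K0 : 0 <= angle_const by rewrite addr_ge0.
have rhs0 : 0 <= 2000 * angle_const * e.
  exact: mulr_ge0 (mulr_ge0 (ler0n _ _) K0) e0.
have [->|y0] := eqVneq y 0; first by rewrite /wedge trmx0 mulmx0 mul0mx subrr mxE normr0; exact: rhs0.
have ny : 0 < vnorm y by rewrite lt_def vnorm_eq0 y0 vnorm_ge0.
have yy : 0 < dot y y by rewrite -sqr_vnorm exprn_gt0.
pose c := dot x y / dot y y; pose z := x - c *: y.
have zy : dot z y = 0 by rewrite /z dotDl dotNl dotZl /c divfK ?subrr // gt_eqF.
have wE : wedge x y = wedge z y.
  by have := wedge_comb x y 1 (- c) 0 1; rewrite scaleNr !scale1r scale0r add0r mulr1 mulr0 subr0 scale1r.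
have [z0|z0] := eqVneq z 0.
  by rewrite wE z0 /wedge trmx0 mul0mx mulmx0 subrr mxE normr0; exact: rhs0.
have nz : 0 < vnorm z by rewrite lt_def vnorm_eq0 z0 vnorm_ge0.
rewrite wE; apply: le_trans (wedge_entry_le _ _ _ _) _.
suff : 1000^-1 < angle_const * ((vnorm z * vnorm y)^-1 * e).
  rewrite mulrCA mulrC ltr_pdivlMr ?mulr_gt0 // => h; lra.
pose p := (vnorm z)^-1; pose q := (vnorm y)^-1.
have unit v : 0 < vnorm v -> dot ((vnorm v)^-1 *: v) ((vnorm v)^-1 *: v) = 1.
  by move=> v0; rewrite dotZl dotZr -sqr_vnorm mulrA -expr2 exprVn mulVf // expf_neq0 // gt_eqF.
apply: (@orthonormal_bound (p * a) (p *: (A - c *: B)) (q *: B) (p *: z) (q *: y)).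
- by apply/antilinear_skewZ/antilinear_skewD => //; rewrite -scaleNr; exact: antilinear_skewZ.
- exact: antilinear_skewZ.
- exact: unit.
- exact: unit.
- by rewrite dotZl dotZr zy !mulr0.
- by rewrite mulr_ge0 // invr_ge0 mulr_ge0 ?vnorm_ge0.
- move=> k l.
  have -> : so_block ((p * a) *: J + p *: (A - c *: B)) (p *: z) =
      p *: so_block (a *: J + A) x + (- (p * c)) *: so_block B y.
    rewrite !so_blockZ so_blockD; congr so_block; rewrite /z;
    by apply/matrixP => ? ?; rewrite !mxE; ring.
  have -> : so_block (q *: B) (q *: y) = 0 *: so_block (a *: J + A) x + q *: so_block B y.
    by rewrite -so_blockZ scale0r add0r.
  rewrite lie_bracket_comb mulr0 subr0 mxE normrM ger0_norm; last first.
    by rewrite mulr_ge0 // invr_ge0 vnorm_ge0.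
  by rewrite invfM ler_wpM2l // mulr_ge0 // invr_ge0 vnorm_ge0.
Qed.

(* Rotating the pair [(X, Y)] makes the second [J]-component vanish. *)
Lemma wedge_bound a b A B x y e :
    antilinear_skew A -> antilinear_skew B -> 0 <= e ->
    (forall i j,
      `|lie_bracket (so_block (a *: J + A) x) (so_block (b *: J + B) y) i j| <= e) ->
  forall i j, `|wedge x y i j| <= 2000 * angle_const * e.
Proof.
move=> As Bs e0 le.
have [ab0|ab] := eqVneq (a ^+ 2 + b ^+ 2) 0.
  have b0 : b = 0.
    by move/eqP: ab0; rewrite paddr_eq0 ?sqr_ge0 // => /andP[_]; rewrite sqrf_eq0 => /eqP.
  by move: le; rewrite b0 scale0r add0r; exact: wedge_bound_antilinear.
(* The rotation with cosine a / r and sine b / r takes the [J]-coordinates (a, b) to (r, 0). *)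
pose r := Num.sqrt (a ^+ 2 + b ^+ 2).
have r2 : r ^+ 2 = a ^+ 2 + b ^+ 2 by rewrite sqr_sqrtr // addr_ge0 // sqr_ge0.
have r0 : r != 0 by rewrite -sqrf_eq0 r2.
have det1 : a / r * (a / r) - b / r * (- (b / r)) = 1.
  by rewrite mulrN opprK -!expr2 !expr_div_n -mulrDl -r2 divff // expf_neq0.
have wE : wedge x y = wedge (a / r *: x + b / r *: y) (- (b / r) *: x + a / r *: y).
  by rewrite wedge_comb det1 scale1r.
rewrite wE; apply: (@wedge_bound_antilinear r (a / r *: A + b / r *: B) (- (b / r) *: A + a / r *: B)) => //.
- by apply: antilinear_skewD; exact: antilinear_skewZ.
- by apply: antilinear_skewD; exact: antilinear_skewZ.
move=> i j.
have -> : so_block (r *: J + (a / r *: A + b / r *: B)) (a / r *: x + b / r *: y) =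
    a / r *: so_block (a *: J + A) x + b / r *: so_block (b *: J + B) y.
  rewrite !so_blockZ so_blockD; congr so_block.
  have rE : a / r * a + b / r * b = r.
    by rewrite !(mulrAC _ r^-1) -mulrDl -!expr2 -r2 expr2 mulfK.
  transitivity ((a / r * a + b / r * b) *: J + (a / r *: A + b / r *: B)).
    by rewrite rE.
  by apply/matrixP => ? ?; rewrite !mxE; ring.
have -> : so_block (- (b / r) *: A + a / r *: B) (- (b / r) *: x + a / r *: y) =
    - (b / r) *: so_block (a *: J + A) x + a / r *: so_block (b *: J + B) y.
  rewrite !so_blockZ so_blockD; congr so_block.
  by apply/matrixP => ? ?; rewrite !mxE; ring.
by rewrite lie_bracket_comb det1 scale1r.
Qed.

Lemma bracket_bound : exists2 C : R, 0 < C & forall a b A B x y e,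
    antilinear_skew A -> antilinear_skew B -> 0 <= e ->
    (forall i j,
      `|lie_bracket (so_block (a *: J + A) x) (so_block (b *: J + B) y) i j| <= e) ->
  forall i j, `|lie_bracket (a *: J + A) (b *: J + B) i j| <= C * e.
Proof.
(* The summand 1 pays for the upper-left block of the bracket, the rest for the wedge added to
   it. *)
exists (2000 * angle_const + 1).
  apply: ltr_wpDl ltr01; apply: mulr_ge0 (ler0n _ _) _.
  exact: addr_ge0 (ler0n _ _) ler01.
move=> a b A B x y e As Bs e0 le i j; have w := wedge_bound As Bs e0 le i j.
have := le (lshift 1 i) (lshift 1 j); rewrite lie_bracket_so_block block_mxEul.
rewrite [X in `|X| <= _ -> _]mxE [X in _ + X]mxE => h.
rewrite -[X in `|X|](subrK (wedge x y i j)) mulrDl mul1r addrC.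
by apply: le_trans (ler_normD _ _) _; rewrite lerD.
Qed.
End WedgeBound.

(** * Lie algebras of matrix groups *)

Section MatrixCurves.
Variable R : realType.

Lemma is_derive_mxP m p (c : R -> 'M[R]_(m, p)) (A : 'M[R]_(m, p)) (t : R) :
  is_derive t (1 : R) c A <-> forall i j, is_derive t (1 : R) (fun s => c s i j) (A i j).
Proof.
split=> [[dc <-] i j|h].
  by rewrite derive_mx // mxE; apply/derivableP; exact: (derivable_mxP _ _ _).1.
have dc : derivable c t 1 by apply/derivable_mxP => i j; have [] := h i j.
apply: DeriveDef => //; rewrite derive_mx //; apply/matrixP => i j; rewrite mxE.
by have [_ ->] := h i j.
Qed.

Lemma is_derive_unique (f : R -> R) (t a b : R) :
  is_derive t (1 : R) f a -> is_derive t (1 : R) f b -> a = b.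
Proof. by move=> [_ <-] [_ <-]. Qed.

Lemma is_derive_quadratic_error (f : R -> R) (a K : R) :
  (forall h, `|f h - f 0 - h * a| <= K * h ^+ 2) -> is_derive (0 : R) (1 : R) f a.
Proof.
move=> fK; have K0 : 0 <= K.
  by apply: le_trans (normr_ge0 _) _; last by have := fK 1; rewrite expr1n mulr1; exact.
have lim : (fun h : R => h^-1 *: (f (h *: 1 + 0) - f 0)) @ 0^' --> a.
  apply/cvgrPdist_le => e e0; near=> h.
  have h0 : h != 0 by near: h; exact: nbhs_dnbhs_neq.
  rewrite addr0 /GRing.scale /= mulr1.
  have -> : a - h^-1 * (f h - f 0) = - (h^-1 * (f h - f 0 - h * a)).
    by rewrite !mulrBr mulKf //; ring.
  rewrite normrN normrM normfV mulrC ler_pdivrMr ?normr_gt0 //.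
  apply: le_trans (fK h) _; rewrite -real_normK ?num_real // expr2 mulrA.
  rewrite ler_wpM2r //; apply: (@le_trans _ _ ((K + 1) * `|h|)).
    by rewrite ler_wpM2r // lerDl.
  rewrite -ler_pdivlMl ?ltr_wpDl //; near: h.
  apply: dnbhs0_le; rewrite mulr_gt0 // invr_gt0 ltr_wpDl //.
by apply: DeriveDef; [apply: cvgP lim | exact: cvg_lim lim].
Unshelve. all: by end_near.
Qed.

End MatrixCurves.

Section LieAlgebraSO.
Variables (R : realType) (N : nat).
Implicit Types A : 'M[R]_N.

Lemma orthogonal_entry_le1 (Q : 'M[R]_N) i j : Q^T *m Q = 1%:M -> `|Q i j| <= 1.
Proof.
move=> /matrixP/(_ j j); rewrite !mxE eqxx mulr1n (bigD1 i) //= mxE => h.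
rewrite -(@ler_pXn2r _ 2) ?nnegrE // expr1n real_normK ?num_real // expr2 -h lerDl.
by rewrite sumr_ge0 // => k _; rewrite mxE -expr2 sqr_ge0.
Qed.

Lemma one_sub_skew_unitmx A : A^T = - A -> 1%:M - A \in unitmx.
Proof.
move=> AT; rewrite -row_free_unit -kermx_eq0; apply/rowV0P => v /sub_kermxP.
rewrite mulmxBr mulmx1 => /eqP; rewrite subr_eq0 => /eqP vA.
have h : (v *m A *m v^T) 0 0 = 0.
  have e : (v *m A *m v^T)^T = - (v *m A *m v^T).
    by rewrite !trmx_mul trmxK AT mulNmx mulmxN mulmxA.
  by have /matrixP/(_ 0 0) := e; rewrite !mxE; lra.
move: h; rewrite -vA mxE => /eqP.
rewrite psumr_eq0 => [/allP z|i _]; last by rewrite mxE -expr2 sqr_ge0.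
apply/rowP => i; have := z i (mem_index_enum _).
by rewrite /= mxE -expr2 sqrf_eq0 [RHS]mxE => /eqP.
Qed.

(** The Cayley transform, a rational stand-in for the exponential: it provides curves in SO(N) with
    any prescribed skew velocity. *)
Definition cayley A : 'M[R]_N := invmx (1%:M - A) *m (1%:M + A).

Lemma cayley_SO A : A^T = - A -> SO R N (cayley A).
Proof.
move=> AT; have u := one_sub_skew_unitmx AT.
have u' : 1%:M + A \in unitmx.
  by rewrite -[A]opprK; apply: one_sub_skew_unitmx; rewrite linearN /= AT.
have tE : (1%:M - A)^T = 1%:M + A by rewrite linearB /= trmx1 AT opprK.
have tE' : (1%:M + A)^T = 1%:M - A by rewrite linearD /= trmx1 AT.
split.
  rewrite /cayley trmx_mul trmx_inv tE tE' !mulmxA.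
  have cm : (1%:M - A) *m invmx (1%:M + A) = invmx (1%:M + A) *m (1%:M - A).
    apply: (can_inj (mulKmx u')); rewrite mulKVmx // mulmxA.
    apply: (can_inj (mulmxK u')); rewrite mulmxKV //.
    rewrite !(mulmxDr, mulmxDl, mulmxN, mulNmx, mulmx1, mul1mx).
    by apply/matrixP => i j; rewrite !mxE; ring.
  by rewrite cm -(mulmxA _ (1%:M - A)) mulmxV // mulmx1 mulVmx.
by rewrite det_mulmx det_inv -tE det_tr mulVf // -unitfE -unitmxE.
Qed.

(** An expansion with exact second-order remainder. The entries of [cayley A] are at most 1 by
    orthogonality, so the remainder is quadratically small without any estimate of an inverse. *)
Lemma cayley_eq A : A^T = - A -> cayley A = 1%:M + 2 *: A + (1%:M + cayley A) *m (A *m A).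
Proof.
move=> AT; have u := one_sub_skew_unitmx AT.
have cE : (1%:M - A) *m cayley A = 1%:M + A by rewrite mulKVmx.
have oc : 1%:M + cayley A = 2 *: invmx (1%:M - A).
  apply: (can_inj (mulKmx u)); rewrite mulmxDr mulmx1 cE -scalemxAr mulmxV //.
  by apply/matrixP => i j; rewrite !mxE; ring.
apply: (can_inj (mulKmx u)); rewrite cE oc !mulmxDr mulmx1 -!scalemxAl -!scalemxAr mulKVmx // mulmxBl mul1mx.
by apply/matrixP => i j; rewrite !mxE; ring.
Qed.

Lemma lie_algebra_SO A : lie_algebra (SO R N) A <-> A^T = - A.
Proof.
split=> [[c [cG c0 /is_derive_mxP dc]]|AT].
  have h i j : A i j + A j i = 0.
    apply: (@is_derive_unique _ (fun s => ((c s)^T *m c s) i j) 0); last first.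
      have -> : (fun s => ((c s)^T *m c s) i j) = cst ((1%:M : 'M[R]_N) i j).
        by apply/funext => s; have [-> _] := cG s.
      exact: is_derive_cst.
    have -> : (fun s => ((c s)^T *m c s) i j) =
        \sum_(k < N) ((fun s => c s k i) * (fun s => c s k j)).
      by apply/funext => s; rewrite mxE fct_sumE; apply: eq_bigr => k _; rewrite mxE.
    have : is_derive (0 : R) (1 : R)
        (\sum_(k < N) ((fun s => c s k i) * (fun s => c s k j)))
        (\sum_(k < N) (c 0 k i *: A k j + c 0 k j *: A k i)).
      by apply: is_derive_sum => k; exact: is_deriveM.
    move/is_derive_eq; apply; rewrite c0 big_split /=.
    have one p q : \sum_k (1%:M : 'M[R]_N) k p *: A k q = A p q.
      rewrite (bigD1 p) //= big1 ?addr0 => [|k kp]; rewrite mxE ?eqxx ?scale1r //.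
      by rewrite (negbTE kp) scale0r.
    by rewrite !one.
  apply/matrixP => i j; rewrite !mxE; have := h i j; lra.
have tAT t : (t *: A)^T = - (t *: A) by rewrite linearZ /= AT scalerN.
(* The argument is halved because [cayley A] begins with 1 + 2 A. *)
exists (fun t => cayley (t / 2 *: A)); split.
- by move=> t; exact: cayley_SO.
- by rewrite mul0r scale0r /cayley subr0 addr0 invmx1 mulmx1.
apply/is_derive_mxP => i j.
pose S := \sum_k `|(A *m A) k j|.
apply: (is_derive_quadratic_error (K := 2^-1 * S)) => h.
rewrite mul0r scale0r [cayley 0](_ : _ = 1%:M); last first.
  by rewrite /cayley subr0 addr0 invmx1 mulmx1.
set Q := cayley _; have QE : Q = 1%:M + h *: A + (h ^+ 2 / 4) *: ((1%:M + Q) *m (A *m A)).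
  rewrite {1}/Q cayley_eq // -/Q -scalemxAl -!scalemxAr !scalerA.
  by apply/matrixP => p q; rewrite !mxE; field.
have Qo k : `|(1%:M + Q) i k| <= 2.
  rewrite mxE; apply: le_trans (ler_normD _ _) _; rewrite -[2]/(1 + 1) lerD //.
    by rewrite mxE; case: eqP; rewrite ?normr1 ?normr0.
  by apply: orthogonal_entry_le1; have [] := cayley_SO (tAT (h / 2)).
have -> : Q i j - (1%:M : 'M[R]_N) i j - h * A i j =
    h ^+ 2 / 4 * ((1%:M + Q) *m (A *m A)) i j.
  rewrite {1}QE; move: (_ *m _) => W; rewrite !mxE; ring.
rewrite normrM [`|h ^+ 2 / 4|]ger0_norm ?divr_ge0 ?sqr_ge0 //.
have : `|((1%:M + Q) *m (A *m A)) i j| <= 2 * S.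
  rewrite [X in `|X|]mxE; apply: le_trans (ler_norm_sum _ _ _) _; rewrite mulr_sumr.
  by apply: ler_sum => k _; rewrite normrM ler_wpM2r.
move/(ler_wpM2l (sqr_ge0 h)); lra.
Qed.

End LieAlgebraSO.

Section FixLast.
Variables (R : realType) (N : nat).

Definition pad (D : 'M[R]_N) : 'M[R]_(N + 1) := block_mx D 0 0 0.

Lemma lie_algebra_fix_last (G : set 'M[R]_N) (X : 'M[R]_(N + 1)) :
  lie_algebra [set fix_last A | A in G] X <-> exists2 D, lie_algebra G D & X = pad D.
Proof.
split=> [[c [cG c0 /is_derive_mxP dc]]|[D [c [cG c0 /is_derive_mxP dc]] ->]].
  have cE t : c t = fix_last (ulsubmx (c t)).
    by have [A _ <-] := cG t; rewrite /fix_last block_mxKul.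
  exists (ulsubmx X).
    exists (fun t => ulsubmx (c t)); split.
    - by move=> t; have [A GA <-] := cG t; rewrite /fix_last block_mxKul.
    - by rewrite c0 scalar_mx_block block_mxKul.
    - apply/is_derive_mxP => i j; rewrite !mxE.
      have -> : (fun s => ulsubmx (c s) i j) = (fun s => c s (lshift 1 i) (lshift 1 j)).
        by apply/funext => s; rewrite !mxE.
      exact: dc.
  (* Outside the upper-left block the entries are constant along the curve, so its velocity vanishes
     there. *)
  have z i j a : (forall s, c s i j = a) -> X i j = 0.
    move=> ca; apply: (is_derive_unique (dc i j)).
    have -> : (fun s => c s i j) = cst a by apply/funext => s; rewrite ca.
    exact: is_derive_cst.
  rewrite -[LHS]submxK /pad; congr block_mx; apply/matrixP => i j; rewrite !mxE.
  - by apply: (z _ _ 0) => s; rewrite cE /fix_last block_mxEur mxE.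
  - by apply: (z _ _ 0) => s; rewrite cE /fix_last block_mxEdl mxE.
  - by apply: (z _ _ 1) => s; rewrite cE /fix_last block_mxEdr !ord1 mxE.
exists (fun t => fix_last (c t)); split.
- by move=> t; exists (c t).
- by rewrite c0 /fix_last -scalar_mx_block.
apply/is_derive_mxP => i j; rewrite /fix_last /pad.
case: (split_ordP i) => i' ->; case: (split_ordP j) => j' ->;
  rewrite ?block_mxEul ?block_mxEur ?block_mxEdl ?block_mxEdr.
- have -> : (fun s => block_mx (c s) 0 0 1%:M (lshift 1 i') (lshift 1 j')) =
      (fun s => c s i' j') by apply/funext => s; rewrite block_mxEul.
  exact: dc.
- have -> : (fun s => block_mx (c s) 0 0 1%:M (lshift 1 i') (rshift N j')) = cst 0.
    by apply/funext => s; rewrite block_mxEur mxE.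
  by rewrite mxE; exact: is_derive_cst.
- have -> : (fun s => block_mx (c s) 0 0 1%:M (rshift N i') (lshift 1 j')) = cst 0.
    by apply/funext => s; rewrite block_mxEdl mxE.
  by rewrite mxE; exact: is_derive_cst.
- have -> : (fun s => block_mx (c s) 0 0 1%:M (rshift N i') (rshift N j')) = cst 1.
    by apply/funext => s; rewrite block_mxEdr !ord1 mxE.
  by rewrite mxE; exact: is_derive_cst.
Qed.

End FixLast.

(** * One-parameter subgroups of SU(n) *)

Section SUGenerators.
Local Open Scope sesquilinear_scope.
Variables (R : realType) (n : nat).
Local Notation C := R[i].

Lemma realifyD (U V : 'M[C]_n) : realify (U + V) = realify U + realify V.
Proof. by apply/matrixP => i j; rewrite !mxE !raddfD /= !mulrDl; ring. Qed.

Lemma realifyZ (c : R) (U : 'M[C]_n) : realify (c%:C%C *: U) = c *: realify U.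
Proof.
apply/matrixP => i j; rewrite !mxE; case: (U _ _) => a b /=.
by rewrite !mul0r subr0 addr0; ring.
Qed.

Section OneParameterGroup.
Variables Z W : 'M[C]_n.
Hypothesis ZH : Z^t* = - Z.
Hypothesis ZZZ : Z *m Z *m Z = - Z.
Hypothesis Wu : W \in unitmx.
Hypothesis WZ : W *m Z = - (Z *m W).

(** The exponential of t Z in closed form (Rodrigues' formula), available because Z^3 = -Z. *)
Let expZ (t : R) : 'M[C]_n :=
  1%:M + (1 - cos t)%:C%C *: (Z *m Z) + (sin t)%:C%C *: Z.

Let expZD s t : expZ (s + t) = expZ s *m expZ t.
Proof.
rewrite /expZ; set a := (1 - cos s)%:C%C; set b := (sin s)%:C%C.
set c := (1 - cos t)%:C%C; set d := (sin t)%:C%C.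
have -> : (1 - cos (s + t))%:C%C = a + c - a * c + b * d.
  rewrite /a /b /c /d cosD -!rmorphM -!rmorphD -!rmorphN -!rmorphD; congr (_%:C%C); ring.
have -> : (sin (s + t))%:C%C = b + d - a * d - b * c.
  rewrite /a /b /c /d sinD -!rmorphM -!rmorphN -!rmorphD; congr (_%:C%C); ring.
rewrite !mulmxDl !mulmxDr !mul1mx !mulmx1 -!scalemxAl -!scalemxAr !scalerA !mulmxA ZZZ.
rewrite mulNmx !scalerN.
move: (Z *m Z) => ZZ; clearbody a b c d.
by apply/matrixP => i j; rewrite !mxE; ring.
Qed.

Let expZ0 : expZ 0 = 1%:M.
Proof. by rewrite /expZ cos0 sin0 subrr !scale0r !addr0. Qed.

Let expZN t : expZ t *m expZ (- t) = 1%:M.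
Proof. by rewrite -expZD subrr. Qed.

Let expZ_adj t : (expZ t)^t* = expZ (- t).
Proof.
rewrite /expZ cosN sinN; have ZZH : (Z *m Z)^t* = Z *m Z.
  by rewrite trmx_mul map_mxM ZH mulNmx mulmxN opprK.
have cr (c : R) (M : 'M[C]_n) : (c%:C%C *: M)^t* = c%:C%C *: M^t*.
  apply/matrixP => i j; rewrite !mxE rmorphM; congr (_ * _).
  by apply/CrealP; rewrite complex_real.
rewrite !linearD /= trmx1 !map_mxD map_mx1 !cr ZZH ZH rmorphN scaleNr scalerN.
by [].
Qed.

Let expZ_unitary t : expZ t \is unitarymx.
Proof. by apply/unitarymxP; rewrite expZ_adj. Qed.

(** Conjugation by [W] reverses the parameter, so the determinant at s equals its own inverse and
    has square 1; writing t as twice t / 2 removes the sign. This replaces the formula relating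
    determinant and trace. *)
Let det_expZ t : \det (expZ t) = 1.
Proof.
have detN s : \det (expZ s) = \det (expZ (- s)).
  have e : W *m expZ s = expZ (- s) *m W.
    have WZZ : W *m (Z *m Z) = Z *m Z *m W.
      by rewrite mulmxA WZ mulNmx -(mulmxA Z W) WZ mulmxN opprK mulmxA.
    rewrite /expZ cosN sinN rmorphN !mulmxDr !mulmxDl mulmx1 mul1mx.
    by rewrite -!scalemxAl -!scalemxAr WZZ WZ scalerN scaleNr.
  have := congr1 determinant e; rewrite !det_mulmx mulrC.
  by apply: mulIf; move: Wu; rewrite unitmxE unitfE.
have det2 s : \det (expZ s) ^+ 2 = 1.
  by rewrite expr2 {2}detN -det_mulmx expZN det1.
by rewrite [t]splitr expZD det_mulmx -expr2 det2.
Qed.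

Lemma realify1 : realify (1%:M : 'M[C]_n) = 1%:M.
Proof.
rewrite /realify -[RHS](tens11 R n 2); apply/matrixP => i j; rewrite !mxE.
by case: eqP => _ /=; rewrite ?(mul0r, mul1r, addr0).
Qed.

Lemma su_generator :
  lie_algebra [set fix_last (realify U) | U in SU R n] (pad (realify Z)).
Proof.
have -> : [set fix_last (realify U) | U in SU R n] =
    [set fix_last A | A in [set realify U | U in SU R n]].
  by rewrite image_comp.
apply/lie_algebra_fix_last; exists (realify Z) => //.
exists (fun t => realify (expZ t)); split.
- by move=> t; exists (expZ t); first (split; [exact: expZ_unitary | exact: det_expZ]).
- by rewrite expZ0 realify1.
apply/is_derive_mxP => i j.
have -> : (fun s => realify (expZ s) i j) =
    cst ((1%:M : 'M[R]_(n * 2)) i j) + (realify (Z *m Z) i j \*: (cst 1 - cos)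
      + realify Z i j \*: sin).
  apply/funext => s; rewrite /expZ !realifyD !realifyZ realify1 !mxE -addrA.
  by congr (_ + (_ + _)); rewrite mulrC.
have := is_deriveD (is_derive_cst ((1%:M : 'M[R]_(n * 2)) i j) (0 : R) (1 : R))
  (is_deriveD (is_deriveZ (realify (Z *m Z) i j)
      (is_deriveB (is_derive_cst (1 : R) (0 : R) (1 : R)) (is_derive_cos (0 : R))))
    (is_deriveZ (realify Z i j) (is_derive_sin (0 : R)))).
move/is_derive_eq; apply.
by rewrite sin0 cos0 oppr0 subr0 scaler0 !add0r /GRing.scale /= mulr1.
Qed.
End OneParameterGroup.
End SUGenerators.

(** * The orthogonal complement of su(n) *)

Section Generators.
Local Open Scope sesquilinear_scope.
Variables (R : realType) (n : nat).
Local Notation C := R[i].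
Local Notation toC := (map_mx (real_complex R)).
Local Notation H := [set fix_last (realify U) | U in SU R n].
Local Notation E := (@delta_mx C n n).
Local Notation e := (@delta_mx R n n).

Lemma realify_real (M : 'M[R]_n) : realify (toC M) = M *t 1%:M.
Proof. by apply/matrixP => i j; rewrite !mxE /= mul0r addr0. Qed.

Lemma realify_imag (M : 'M[R]_n) : realify ('i *: toC M) = M *t rot90 R.
Proof.
apply/matrixP => i j; rewrite !mxE -complexiE /=.
by rewrite !(mul0r, mulr0, mul1r, subr0, add0r) oppr0 mul0r add0r.
Qed.

Section Pair.
Variables j k : 'I_n.
Hypothesis jk : j != k.
Let kj : (k == j) = false. Proof. by rewrite eq_sym (negbTE jk). Qed.
Ltac delta_ring := rewrite !(mulmxDl, mulmxDr, mulmxBl, mulmxBr, mulmxN, mulNmx,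
    mul1mx, mulmx1, mul0mx, mulmx0, mul_delta_mx_cond, eqxx, negbTE jk, kj, mulr0n, mulr1n);
  apply/matrixP => p q; rewrite !mxE; ring.

Let toCd a b : toC (e a b) = E a b.
Proof. by apply/matrixP => p q; rewrite !mxE rmorph_nat. Qed.

Let adjE a b : (E a b)^t* = E b a.
Proof. by rewrite trmx_delta; apply/matrixP => p q; rewrite !mxE rmorph_nat. Qed.

Let adjI (M : 'M[C]_n) : ('i *: M)^t* = - ('i *: M^t*).
Proof. by apply/matrixP => p q; rewrite !mxE -mulNr -conjCi -rmorphM. Qed.

(** The reflection that changes the sign of coordinate [j]; it anticommutes with the generators
    supported on the entries (j, k) and (k, j). *)
Let W := 1%:M - E j j - E j j.
Let Wu : W \in unitmx.
Proof.
suff /mulmx1_unit[] : W *m W = 1%:M by [].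
rewrite /W; delta_ring.
Qed.

(** The exchange of coordinates [j] and [k]; it anticommutes with [E j j - E k k]. *)
Let V := 1%:M - E j j - E k k + E j k + E k j.
Let Vu : V \in unitmx.
Proof.
suff /mulmx1_unit[] : V *m V = 1%:M by [].
rewrite /V; delta_ring.
Qed.

Lemma su_generator_real : lie_algebra H (pad ((e j k - e k j) *t 1%:M)).
Proof.
rewrite -realify_real map_mxB !toCd; apply: (su_generator (W := W) _ _ Wu).
- by rewrite linearB map_mxB /= !adjE opprB.
- delta_ring.
- rewrite /W; delta_ring.
Qed.

Lemma su_generator_imag : lie_algebra H (pad ((e j k + e k j) *t rot90 R)).
Proof.
rewrite -realify_imag map_mxD !toCd; apply: (su_generator (W := W) _ _ Wu).
- by rewrite adjI linearD map_mxD /= !adjE addrC.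
- rewrite -!scalemxAl -!scalemxAr -!scalemxAl !scalerA -expr2 sqrCi ?mulN1r ?mulrN1 scaleNr.
  congr (- (_ *: _)); delta_ring.
- rewrite -scalemxAl -scalemxAr -scalerN; congr (_ *: _).
  rewrite /W; delta_ring.
Qed.

Lemma su_generator_diag : lie_algebra H (pad ((e j j - e k k) *t rot90 R)).
Proof.
rewrite -realify_imag map_mxB !toCd; apply: (su_generator (W := V) _ _ Vu).
- by rewrite adjI linearB map_mxB /= !adjE.
- rewrite -!scalemxAl -!scalemxAr -!scalemxAl !scalerA -expr2 sqrCi ?mulN1r ?mulrN1 scaleNr.
  congr (- (_ *: _)); delta_ring.
- rewrite -scalemxAl -scalemxAr -scalerN; congr (_ *: _).
  rewrite /V; delta_ring.
Qed.

End Pair.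
End Generators.

(** * The Frobenius product and tensor products *)

Section MatrixDot.
Variable R : comPzRingType.

Definition mxdot m p (X Y : 'M[R]_(m, p)) : R := \sum_i \sum_j X i j * Y i j.

Lemma mxdotC m p (X Y : 'M[R]_(m, p)) : mxdot X Y = mxdot Y X.
Proof. by apply: eq_bigr => i _; apply: eq_bigr => j _; rewrite mulrC. Qed.

Lemma sum_mxtens (T : nmodType) m p (F : 'I_(m * p) -> T) :
  \sum_i F i = \sum_j \sum_s F (mxtens_index (j, s)).
Proof.
rewrite (reindex (@mxtens_index m p)) /=; last first.
  by apply: onW_bij; exists (@mxtens_unindex m p); [exact: mxtens_indexK | exact: mxtens_unindexK].
by rewrite pair_big; apply: eq_bigr => -[].
Qed.

Lemma mxdot_tens m p q r (D : 'M[R]_(m * q, p * r)) (M : 'M[R]_(m, p)) (T : 'M[R]_(q, r)) :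
  mxdot D (M *t T) = \sum_j \sum_k M j k *
    (\sum_s \sum_t T s t * D (mxtens_index (j, s)) (mxtens_index (k, t))).
Proof.
rewrite /mxdot sum_mxtens; apply: eq_bigr => j _.
under eq_bigr do rewrite sum_mxtens; rewrite exchange_big; apply: eq_bigr => k _.
rewrite mulr_sumr; apply: eq_bigr => s _; rewrite mulr_sumr; apply: eq_bigr => t _.
by rewrite tensmxE; ring.
Qed.

Lemma mxdot_delta_tens m p q r (D : 'M[R]_(m * q, p * r)) (T : 'M[R]_(q, r)) j k :
  mxdot D (delta_mx j k *t T) =
    \sum_s \sum_t T s t * D (mxtens_index (j, s)) (mxtens_index (k, t)).
Proof.
rewrite mxdot_tens (bigD1 j) //= [X in _ + X]big1 => [|i ij]; last first.
  by rewrite big1 // => l _; rewrite mxE (negbTE ij) mul0r.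
rewrite addr0 (bigD1 k) //= [X in _ + X]big1 => [|i ik]; last first.
  by rewrite mxE (negbTE ik) andbF mul0r.
by rewrite mxE !eqxx mul1r addr0.
Qed.

Lemma mxdotDr m p (X Y Z : 'M[R]_(m, p)) : mxdot X (Y + Z) = mxdot X Y + mxdot X Z.
Proof.
rewrite -big_split; apply: eq_bigr => i _; rewrite -big_split; apply: eq_bigr => j _.
by rewrite mxE mulrDr.
Qed.

Lemma mxdotZr m p (c : R) (X Y : 'M[R]_(m, p)) : mxdot X (c *: Y) = c * mxdot X Y.
Proof.
rewrite mulr_sumr; apply: eq_bigr => i _; rewrite mulr_sumr; apply: eq_bigr => j _.
by rewrite mxE mulrCA.
Qed.

Lemma mxdotNr m p (X Y : 'M[R]_(m, p)) : mxdot X (- Y) = - mxdot X Y.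
Proof. by rewrite -scaleN1r mxdotZr mulN1r. Qed.

End MatrixDot.

Section OrthogonalToSU.
Variables (R : realType) (n : nat).
Local Notation J := (stdJ R n).
Local Notation e := (@delta_mx R n n).

Lemma ord2 (s : 'I_2) : s = 0 \/ s = 1.
Proof. by case: s => [[|[|//]] ?]; [left | right]; apply: val_inj. Qed.

Lemma rot90E : (rot90 R 0 0 = 0) * (rot90 R 0 1 = -1) * (rot90 R 1 0 = 1) * (rot90 R 1 1 = 0).
Proof. by rewrite !mxE. Qed.

Lemma sandwich_J (D : 'M[R]_(n * 2)) j s k t :
  (J *m D *m J) (mxtens_index (j, s)) (mxtens_index (k, t)) =
    \sum_s' \sum_t' rot90 R s s' * D (mxtens_index (j, s')) (mxtens_index (k, t'))
      * rot90 R t' t.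
Proof.
have JE a b c d : J (mxtens_index (a, b)) (mxtens_index (c, d)) = (a == c)%:R * rot90 R b d.
  by rewrite tensmxE mxE.
rewrite mxE sum_mxtens (bigD1 k) //= [X in _ + X]big1 ?addr0 => [|l lk]; last first.
  by rewrite big1 // => t' _; rewrite JE (negbTE lk) mul0r mulr0.
rewrite exchange_big /=; apply: eq_bigr => t' _; rewrite JE eqxx mul1r mxE -mulr_suml.
congr (_ * _); rewrite sum_mxtens (bigD1 j) //= [X in _ + X]big1 ?addr0 => [|l lj]; last first.
  by rewrite big1 // => s' _; rewrite JE eq_sym (negbTE lj) !mul0r.
by apply: eq_bigr => s' _; rewrite JE eqxx mul1r.
Qed.

(** [D - J *m D *m J] is twice the [J]-linear part of [D], a complex n x n matrix. The first family
    kills its real parts, the second its imaginary parts off the diagonal, and the third makes the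
    diagonal imaginary parts equal, which leaves a multiple of [J]. *)
Lemma orthogonal_to_su (D : 'M[R]_(n * 2)) : (0 < n)%N -> D^T = - D ->
    (forall j k, j != k -> mxdot D ((e j k - e k j) *t 1%:M) = 0) ->
    (forall j k, j != k -> mxdot D ((e j k + e k j) *t rot90 R) = 0) ->
    (forall j k, j != k -> mxdot D ((e j j - e k k) *t rot90 R) = 0) ->
  exists a A, antilinear_skew A /\ D = a *: J + A.
Proof.
move=> n0 DT h1 h2 h3; pose d j s k t := D (mxtens_index (j, s)) (mxtens_index (k, t)).
have dC j s k t : d k t j s = - d j s k t.
  by have /matrixP/(_ (mxtens_index (j, s)) (mxtens_index (k, t))) := DT; rewrite !mxE.
have re0 j k : d j 0 k 0 + d j 1 k 1 = 0.
  have [->|jk] := eqVneq j k.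
    by have := dC k 0 k 0; have := dC k 1 k 1; lra.
  have := h1 _ _ jk; rewrite tensmxDl tensmxNl mxdotDr mxdotNr !mxdot_delta_tens.
  rewrite !big_ord_recl !big_ord0 !mxE /= -!/(d _ _ _ _).
  have -> : lift ord0 ord0 = 1 :> 'I_2 by apply: val_inj.
  have := dC j 0 k 0; have := dC j 1 k 1; lra.
have im0 j k : j != k -> d j 1 k 0 - d j 0 k 1 = 0.
  move=> jk.
  have := h2 _ _ jk; rewrite tensmxDl mxdotDr !mxdot_delta_tens.
  rewrite !big_ord_recl !big_ord0 !mxE /= -!/(d _ _ _ _).
  have -> : lift ord0 ord0 = 1 :> 'I_2 by apply: val_inj.
  have := dC j 1 k 0; have := dC j 0 k 1; lra.
pose j0 := Ordinal n0; pose a := d j0 1 j0 0.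
have diag j : d j 1 j 0 = a.
  have [->//|jk] := eqVneq j j0.
  have := h3 _ _ jk; rewrite tensmxDl tensmxNl mxdotDr mxdotNr !mxdot_delta_tens.
  rewrite !big_ord_recl !big_ord0 !mxE /= -!/(d _ _ _ _).
  have -> : lift ord0 ord0 = 1 :> 'I_2 by apply: val_inj.
  rewrite /a; have := dC j 1 j 0; have := dC j0 1 j0 0; lra.
have lin : D - J *m D *m J = (2 * a) *: J.
  apply/matrixP => i i'; case: (mxtens_indexP i) => j s; case: (mxtens_indexP i') => k t.
  rewrite mxE [X in _ + X]mxE sandwich_J [RHS]mxE tensmxE [X in _ = _ * (X * _)]mxE.
  rewrite !big_ord_recl !big_ord0 -!/(d _ _ _ _).
  have -> : lift ord0 ord0 = 1 :> 'I_2 by apply: val_inj.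
  have -> : ord0 = 0 :> 'I_2 by [].
  have := re0 j k; have := diag j; have := dC j 1 j 0.
  case: (ord2 s) => ->; case: (ord2 t) => ->; rewrite ?rot90E;
    have [<-|/im0] := eqVneq j k; rewrite /= ?mulr1n ?mulr0n; lra.
pose A := 2^-1 *: (D + J *m D *m J); exists a, A.
have JDJT : (J *m D *m J)^T = - (J *m D *m J).
  by rewrite !trmx_mul stdJ_tr DT !mulNmx !mulmxN !opprK mulmxA.
split; last first.
  have -> : a *: J = 2^-1 *: (D - J *m D *m J).
    by rewrite lin scalerA mulrA mulVf ?mul1r // pnatr_eq0.
  by apply/matrixP => p q; rewrite !mxE; field.
split.
  by rewrite linearZ linearD /= DT JDJT -opprD scalerN.
rewrite -scalemxAl -scalemxAr -scalerN; congr (_ *: _).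
rewrite mulmxDl mulmxDr !mulmxA stdJ_sqr -!mulmxA stdJ_sqr mulmxN mulmx1 mulNmx mul1mx.
by rewrite mulmxN opprD opprK addrC.
Qed.

End OrthogonalToSU.

(** * Uniqueness of the biinvariant inner product *)

Section SkewBasis.
Variables (R : realType) (N : nat).
Implicit Types (X Y : 'M[R]_N) (i j k l : 'I_N).

Lemma fresh_ord (s : seq 'I_N) : (size s < N)%N -> exists b, b \notin s.
Proof.
move=> sN; have [b bs|all] := pickP [pred b | b \notin s]; first by exists b.
have : (size (enum 'I_N) <= size s)%N.
  by apply: uniq_leq_size (enum_uniq _) _ => b _; have := all b; rewrite inE => /negbFE.
by rewrite size_enum_ord leqNgt sN.
Qed.

Definition skew_delta i j : 'M[R]_N := delta_mx i j - delta_mx j i.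

Lemma skew_delta_tr i j : (skew_delta i j)^T = - skew_delta i j.
Proof. by rewrite linearB /= !trmx_delta opprB. Qed.

Lemma skew_deltaN i j : skew_delta j i = - skew_delta i j.
Proof. by rewrite /skew_delta opprB. Qed.

Lemma skew_delta_sum X : X^T = - X -> X = \sum_i \sum_j (X i j / 2) *: skew_delta i j.
Proof.
move=> XT; have XE i j : X j i = - X i j by have /matrixP/(_ i j) := XT; rewrite !mxE.
transitivity (\sum_i \sum_j (X i j / 2) *: delta_mx i j -
    \sum_i \sum_j (X i j / 2) *: delta_mx j i).
  rewrite [X in _ - X]exchange_big /= -sumrB [LHS]matrix_sum_delta.
  apply: eq_bigr => i _; rewrite -sumrB; apply: eq_bigr => j _.
  by rewrite -scalerBl (XE i j) mulNr opprK -splitr.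
rewrite -sumrB; apply: eq_bigr => i _; rewrite -sumrB; apply: eq_bigr => j _.
by rewrite -scalerBr.
Qed.

Lemma skew_linear_eq0 (f : 'M[R]_N -> R) :
    (forall a X Y, X^T = - X -> Y^T = - Y -> f (a *: X + Y) = a * f X + f Y) ->
    (forall i j, f (skew_delta i j) = 0) ->
  forall X, X^T = - X -> f X = 0.
Proof.
move=> fl f0 X XT; have T0 : (0 : 'M[R]_N)^T = - 0 by rewrite trmx0 oppr0.
have z : f 0 = 0 by have := fl (-1) _ _ T0 T0; rewrite scaler0 addr0; lra.
suff [] : (\sum_i \sum_j (X i j / 2) *: skew_delta i j)^T =
    - (\sum_i \sum_j (X i j / 2) *: skew_delta i j) /\
    f (\sum_i \sum_j (X i j / 2) *: skew_delta i j) = 0 by rewrite -skew_delta_sum.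
(* [f] is linear on skew matrices only, so the induction over the sums carries skewness along. *)
pose P (M : 'M[R]_N) := M^T = - M /\ f M = 0.
have PD M M' : P M -> P M' -> P (M + M').
  move=> [MT fM] [M'T fM']; split; first by rewrite linearD /= MT M'T opprD.
  by rewrite -[M]scale1r fl // fM fM' mulr0 addr0.
apply: (big_ind P) => // i _; apply: (big_ind P) => // j _.
split; first by rewrite linearZ /= skew_delta_tr scalerN.
by rewrite -[_ *: _]addr0 fl ?skew_delta_tr // f0 z mulr0 addr0.
Qed.

Lemma mxdot_delta i j X : mxdot (delta_mx i j) X = X i j.
Proof.
rewrite /mxdot (bigD1 i) //= [X in _ + X]big1 ?addr0 => [|k ki]; last first.
  by rewrite big1 // => l _; rewrite mxE (negbTE ki) mul0r.
rewrite (bigD1 j) //= [X in _ + X]big1 ?addr0 => [|k kj]; last first.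
  by rewrite mxE (negbTE kj) andbF mul0r.
by rewrite mxE !eqxx mul1r.
Qed.

Lemma mxdot_skew_delta i j X : mxdot (skew_delta i j) X = X i j - X j i.
Proof. by rewrite mxdotC mxdotDr mxdotNr !(mxdotC X) !mxdot_delta. Qed.

End SkewBasis.

Section Invariance.
Variables (R : realType) (N : nat) (g : 'M[R]_N -> 'M[R]_N -> R).
Hypothesis N5 : (5 <= N)%N.
Hypothesis gl : forall a X Y Z, X^T = - X -> Y^T = - Y -> Z^T = - Z ->
  g (a *: X + Y) Z = a * g X Z + g Y Z.
Hypothesis gC : forall X Y, X^T = - X -> Y^T = - Y -> g X Y = g Y X.
Hypothesis gAd : forall Q X Y, Q^T *m Q = 1%:M -> \det Q = 1 ->
  X^T = - X -> Y^T = - Y -> g (Q *m X *m Q^T) (Q *m Y *m Q^T) = g X Y.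
Local Notation F := (@skew_delta R N).
Let FT := @skew_delta_tr R N.

Let g0l Z : Z^T = - Z -> g 0 Z = 0.
Proof.
move=> ZT; have T0 : (0 : 'M[R]_N)^T = - 0 by rewrite trmx0 oppr0.
by have := gl (-1) T0 T0 ZT; rewrite scaler0 addr0; lra.
Qed.

Let gZl a X Z : X^T = - X -> Z^T = - Z -> g (a *: X) Z = a * g X Z.
Proof.
move=> XT ZT; rewrite -[_ *: _]addr0 gl ?g0l ?addr0 //.
by rewrite trmx0 oppr0.
Qed.

Let gNl i j Z : Z^T = - Z -> g (F j i) Z = - g (F i j) Z.
Proof. by move=> ZT; rewrite skew_deltaN -scaleN1r gZl // mulN1r. Qed.

(** Changing the signs of coordinates [i] and [b] negates [F i j] and fixes [F k l]. The index [b],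
    distinct from the other four, brings the determinant back to 1; this uses size 5. *)
Lemma invariant_orthogonal i j k l : i != j -> i != k -> i != l -> g (F i j) (F k l) = 0.
Proof.
move=> ij ik il; have [b] := @fresh_ord N [:: i; j; k; l] N5.
rewrite !inE !negb_or => /and4P[bi bj bk bl].
pose d : 'rV[R]_N := \row_p (-1) ^+ ((p == i) + (p == b)).
pose Q := diag_mx d.
have dd p : d 0 p * d 0 p = 1 by rewrite mxE -expr2 sqrr_sign.
have QQ : Q^T *m Q = 1%:M.
  rewrite tr_diag_mx mul_diag_mx; apply/matrixP => p q.
  rewrite [LHS]mxE [X in _ * X]mxE [RHS]mxE.
  by case: (p =P q) => [->|_] /=; rewrite ?mulr0n ?mulr0 // !mulr1n dd.
have Qdet : \det Q = 1.
  rewrite det_diag (bigD1 i) //= (bigD1 b) //= big1 => [|p /andP[pi pb]]; last first.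
    by rewrite mxE (negbTE pi) (negbTE pb).
  by rewrite !mxE !eqxx (negbTE bi) eq_sym (negbTE bi) /= mulr1 mulN1r opprK.
have Qd p q : Q *m delta_mx p q *m Q^T = (d 0 p * d 0 q) *: delta_mx p q.
  rewrite tr_diag_mx mul_mx_diag mul_diag_mx; apply/matrixP => r s.
  rewrite [LHS]mxE [X in X * _]mxE [RHS]mxE [delta_mx p q r s]mxE.
  have [->|_] := eqVneq r p; last by rewrite !(mulr0, mul0r).
  by have [->|_] := eqVneq s q; rewrite ?(mulr0, mul0r) // !mulr1.
have QF p q : Q *m F p q *m Q^T = (d 0 p * d 0 q) *: F p q.
  by rewrite mulmxBr mulmxBl !Qd scalerBr [d 0 q * _]mulrC.
have di : d 0 i = -1 by rewrite mxE eqxx eq_sym (negbTE bi) expr1.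
have d1 p : p != i -> p != b -> d 0 p = 1.
  by move=> pi pb; rewrite mxE (negbTE pi) (negbTE pb) expr0.
have := gAd QQ Qdet (FT i j) (FT k l); rewrite !QF di !d1 // 1?eq_sym //.
rewrite !mulr1 scale1r gZl // => h; lra.
Qed.

(** Exchanging [j] and [k] takes [F i j] to [F i k] but has determinant -1; a disjoint transposition
    of two further indices corrects the sign, so five indices are used again. *)
Lemma invariant_norm i j k : i != j -> i != k -> g (F i j) (F i j) = g (F i k) (F i k).
Proof.
move=> ij ik; have [<-//|jk] := eqVneq j k.
have [l] := @fresh_ord N [:: i; j; k] (ltnW N5).
rewrite !inE !negb_or => /and3P[li lj lk].
have [m] := @fresh_ord N [:: i; j; k; l] N5.
rewrite !inE !negb_or => /and4P[mi mj mk ml].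
pose s := (tperm j k * tperm l m)%g.
have si : s i = i by rewrite permM tpermD 1?eq_sym // tpermD // eq_sym.
have sj : s j = k by rewrite permM tpermL tpermD // eq_sym.
have QQ : (perm_mx s : 'M[R]_N)^T *m perm_mx s = 1%:M.
  by rewrite tr_perm_mx -perm_mxM mulVg perm_mx1.
have Qdet : \det (perm_mx s : 'M[R]_N)^T = 1.
  by rewrite det_tr det_perm odd_permM !odd_tperm jk eq_sym ml.
have Qd p q : (perm_mx s)^T *m delta_mx p q *m perm_mx s = delta_mx (s p) (s q) :> 'M[R]_N.
  rewrite tr_perm_mx -row_permE -{2}[s]invgK -col_permE; apply/matrixP => r t.
  by rewrite !mxE -[s^-1%g r == p](inj_eq (@perm_inj _ s)) -[s^-1%g t == q](inj_eq (@perm_inj _ s)) !permKV.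
have QF p q : (perm_mx s)^T *m F p q *m (perm_mx s)^T^T = F (s p) (s q).
  by rewrite trmxK mulmxBr mulmxBl !Qd.
have QQ' : (perm_mx s)^T^T *m (perm_mx s)^T = 1%:M :> 'M[R]_N.
  by rewrite trmxK mulmx1C.
by rewrite -(gAd QQ' Qdet (FT i j) (FT i j)) QF si sj.
Qed.

Lemma invariant_norm_all i j k l : i != j -> k != l -> g (F i j) (F i j) = g (F k l) (F k l).
Proof.
have gN p q : g (F p q) (F p q) = g (F q p) (F q p).
  by rewrite gNl ?FT // gC ?FT // gNl ?FT // opprK.
move=> ij kl; have [il|il] := eqVneq i l.
  by rewrite (gN k) -il; apply: invariant_norm => //; rewrite il eq_sym.
by rewrite (invariant_norm ij il) gN (gN k); apply: invariant_norm; rewrite eq_sym.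
Qed.

(** On the spanning set [F i j] both forms are diagonal with constant squares, up to the sign in
    [F j i]; for [mxdot] the square is 2, which is the divisor in the constant. *)
Lemma invariant_form_unique (p q : 'I_N) : p != q ->
  forall X Y, X^T = - X -> Y^T = - Y ->
    g X Y = g (F p q) (F p q) / 2 * mxdot X Y.
Proof.
move=> pq; set c := _ / 2.
have key i j k l : g (F i j) (F k l) - c * mxdot (F i j) (F k l) = 0.
  have F0 a : F a a = 0 by rewrite /skew_delta subrr.
  have m0 X : mxdot (0 : 'M[R]_N) X = 0 by rewrite -(F0 i) mxdot_skew_delta subrr.
  have [<-|ij] := eqVneq i j; first by rewrite F0 g0l ?FT // m0 mulr0 subr0.
  have [<-|kl] := eqVneq k l.
    by rewrite F0 gC ?g0l ?FT ?trmx0 ?oppr0 // mxdotC m0 mulr0 subr0.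
  have case1 a b : a != b -> a != k -> a != l ->
      g (F a b) (F k l) - c * mxdot (F a b) (F k l) = 0.
    move=> ab ak al; rewrite invariant_orthogonal // mxdot_skew_delta !mxE.
    by rewrite (negbTE ak) (negbTE al) !andbF !subrr mulr0 subrr.
  have cN a b Z : mxdot (F b a) Z = - mxdot (F a b) Z by rewrite !mxdot_skew_delta opprB.
  have caseN a b : g (F a b) (F k l) - c * mxdot (F a b) (F k l) = 0 ->
      g (F b a) (F k l) - c * mxdot (F b a) (F k l) = 0.
    by rewrite (gNl a b) ?FT // (cN a b); lra.
  have nE a b : a != b -> mxdot (F a b) (F a b) = 2.
    move=> ab; rewrite mxdot_skew_delta !mxE !eqxx (negbTE ab) /= eq_sym (negbTE ab) /=.
    by rewrite subr0 sub0r opprK.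
  have case2 a b : a != b -> g (F a b) (F a b) - c * mxdot (F a b) (F a b) = 0.
    by move=> ab; rewrite nE // (invariant_norm_all ab pq) /c divfK ?subrr // pnatr_eq0.
  have [ik|ik] := eqVneq i k; have [il|il] := eqVneq i l.
  - by rewrite -ik il eqxx in kl.
  - have [jl|jl] := eqVneq j l; first by rewrite -ik -jl; exact: case2.
    by apply: caseN; apply: case1; [rewrite eq_sym | rewrite -ik eq_sym |].
  - have [jk|jk] := eqVneq j k; first by apply: caseN; rewrite jk il; exact: case2.
    by apply: caseN; apply: case1; [rewrite eq_sym | | rewrite -il eq_sym].
  - exact: case1.
have mxdotl a X Y Z : mxdot (a *: X + Y) Z = a * mxdot X Z + mxdot Y Z :> R.
  by rewrite mxdotC mxdotDr mxdotZr !(mxdotC Z).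
have key2 i j Y : Y^T = - Y -> g (F i j) Y - c * mxdot (F i j) Y = 0.
  apply: (skew_linear_eq0 (f := fun Y => g (F i j) Y - c * mxdot (F i j) Y)) => // a X Z XT ZT.
  rewrite gC ?FT //; last by rewrite linearD linearZ /= XT ZT scalerN opprD.
  rewrite gl ?FT // !(gC _ (FT i j)) // mxdotC mxdotl !(mxdotC _ (F i j)); ring.
move=> X Y XT YT; apply/eqP; rewrite -subr_eq0; apply/eqP.
apply: (skew_linear_eq0 (f := fun X => g X Y - c * mxdot X Y)) => // [a Z W ZT WT|i j].
  by rewrite gl // mxdotl; ring.
exact: key2.
Qed.

End Invariance.

(** * The bracket condition *)

Section Frobenius.
Variable R : realType.

Lemma mxdot_ge0 m p (X : 'M[R]_(m, p)) : 0 <= mxdot X X.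
Proof. by apply: sumr_ge0 => i _; apply: sumr_ge0 => j _; rewrite -expr2 sqr_ge0. Qed.

Lemma entry_le_mxdot m p (X : 'M[R]_(m, p)) i j : X i j ^+ 2 <= mxdot X X.
Proof.
rewrite /mxdot (bigD1 i) //= (bigD1 j) //= -expr2 -addrA lerDl addr_ge0 //.
  by apply: sumr_ge0 => l _; rewrite -expr2 sqr_ge0.
by apply: sumr_ge0 => k _; apply: sumr_ge0 => l _; rewrite -expr2 sqr_ge0.
Qed.

Lemma mxdot_eq0 m p (X : 'M[R]_(m, p)) : mxdot X X = 0 -> X = 0.
Proof.
move=> X0; apply/matrixP => i j; have := entry_le_mxdot X i j; rewrite X0 mxE => h.
by apply/eqP; rewrite -sqrf_eq0 eq_le h sqr_ge0.
Qed.

Lemma mxdot_le_entries m (X : 'M[R]_m) (c : R) :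
  (forall i j, `|X i j| <= c) -> mxdot X X <= (m%:R * c) ^+ 2.
Proof.
move=> Xc; have -> : (m%:R * c) ^+ 2 = \sum_(i < m) \sum_(j < m) c ^+ 2.
  by rewrite !sumr_const !card_ord -mulrnA -[RHS]mulr_natl natrM exprMn -expr2.
apply: ler_sum => i _; apply: ler_sum => j _; rewrite -expr2 -real_normK ?num_real //.
by rewrite ler_sqr ?nnegrE // (le_trans _ (Xc i j)).
Qed.

Lemma mxdot_block m1 m2 (A A' : 'M[R]_m1) B B' D D' (E E' : 'M[R]_m2) :
  mxdot (block_mx A B D E) (block_mx A' B' D' E') =
    mxdot A A' + mxdot B B' + (mxdot D D' + mxdot E E').
Proof.
rewrite /mxdot big_split_ord /=; congr (_ + _).
  rewrite -big_split; apply: eq_bigr => i _; rewrite big_split_ord /=; congr (_ + _);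
  by apply: eq_bigr => j _; rewrite ?block_mxEul ?block_mxEur.
rewrite -big_split; apply: eq_bigr => i _; rewrite big_split_ord /=; congr (_ + _);
by apply: eq_bigr => j _; rewrite ?block_mxEdl ?block_mxEdr.
Qed.

Lemma mxdot0 m p (X : 'M[R]_(m, p)) : mxdot X 0 = 0.
Proof. by rewrite -(scale0r X) mxdotZr mul0r. Qed.

Lemma mxdotBl m p (X Y Z : 'M[R]_(m, p)) : mxdot (X - Y) Z = mxdot X Z - mxdot Y Z.
Proof. by rewrite mxdotC mxdotDr mxdotNr !(mxdotC Z). Qed.

Lemma mxdot_pad m (X : 'M[R]_(m + 1)) (D : 'M[R]_m) : mxdot X (pad D) = mxdot (ulsubmx X) D.
Proof. by rewrite -{1}[X]submxK /pad mxdot_block !mxdot0 !addr0. Qed.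

End Frobenius.

Lemma skewB (R : realType) N (X Y : 'M[R]_N) : X^T = - X -> Y^T = - Y -> (X - Y)^T = - (X - Y).
Proof. by move=> XT YT; rewrite linearB /= XT YT opprD. Qed.

Lemma lie_bracket_skew (R : realType) N (X Y : 'M[R]_N) :
  X^T = - X -> Y^T = - Y -> (lie_bracket X Y)^T = - lie_bracket X Y.
Proof.
by move=> XT YT; rewrite /lie_bracket linearB /= !trmx_mul XT YT !mulNmx !mulmxN !opprK opprB.
Qed.

(** * From entries to norms and projections *)

Section Assembly.
Variables (R : realType) (n : nat).
Hypothesis hn : (2 <= n)%N.
Local Notation m := (n * 2)%N.
Variables (g0 : 'M[R]_(m + 1) -> 'M[R]_(m + 1) -> R) (c : R).
Hypothesis c0 : 0 < c.
Hypothesis gE : forall X Y, X^T = - X -> Y^T = - Y -> g0 X Y = c * mxdot X Y.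
Local Notation h := (lie_algebra [set fix_last (realify U) | U in SU R n]).
Local Notation k := (lie_algebra [set fix_last A | A in SO R m]).
Local Notation mm := (orth_compl g0 h k).
Local Notation ss := (orth_compl g0 k (lie_algebra (SO R (m + 1)))).

Let g_eq0 X Y : X^T = - X -> Y^T = - Y -> g0 X Y = 0 -> mxdot X Y = 0.
Proof. by move=> XT YT; rewrite gE // => /eqP; rewrite mulf_eq0 gt_eqF //= => /eqP. Qed.

Lemma pad_skew D : D^T = - D -> (pad D)^T = - pad D :> 'M[R]_(m + 1).
Proof. by move=> DT; rewrite /pad tr_block_mx DT !trmx0 opp_block_mx !oppr0. Qed.

Lemma k_pad X : k X <-> exists2 D, D^T = - D & X = pad D.
Proof.
rewrite lie_algebra_fix_last; split=> -[D].
  by move=> /lie_algebra_SO DT ->; exists D.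
by move=> DT ->; exists D => //; apply/lie_algebra_SO.
Qed.

Lemma k_skew X : k X -> X^T = - X.
Proof. by move=> /k_pad[D DT ->]; exact: pad_skew. Qed.

Lemma m_decomp X : mm X -> exists a A, antilinear_skew A /\ X = pad (a *: stdJ R n + A).
Proof.
move=> [/k_pad[D DT ->] orth].
have dot0 Z : Z^T = - Z -> h (pad Z) -> mxdot D Z = 0.
  move=> ZT hZ; have := g_eq0 (pad_skew DT) (pad_skew ZT) (orth _ hZ).
  by rewrite mxdot_pad /pad block_mxKul.
have [||j l jl|j l jl|j l jl|a [A [As DE]]] := @orthogonal_to_su R n D.
- exact: ltnW.
- exact: DT.
- apply: dot0; last exact: su_generator_real.
  by rewrite trmx_tens trmx1 linearB /= !trmx_delta -tensmxNl opprB.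
- apply: dot0; last exact: su_generator_imag.
  by rewrite trmx_tens rot90_tr linearD /= !trmx_delta addrC tensmxNr.
- apply: dot0; last exact: su_generator_diag.
  by rewrite trmx_tens rot90_tr linearB /= !trmx_delta tensmxNr.
by exists a, A; rewrite DE.
Qed.

Lemma s_decomp X : ss X -> exists x, X = so_block 0 x.
Proof.
move=> [/lie_algebra_SO XT orth]; exists (ursubmx X).
have XE : (block_mx (ulsubmx X) (ursubmx X) (dlsubmx X) (drsubmx X))^T =
   - block_mx (ulsubmx X) (ursubmx X) (dlsubmx X) (drsubmx X) by rewrite submxK.
move: XE; rewrite tr_block_mx opp_block_mx => /eq_block_mx[ulT dlT urT drT].
have ul0 : ulsubmx X = 0.
  (* The upper-left block is tested against itself, so orthogonality to k makes its square
     vanish. *)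
  have kD : k (pad (ulsubmx X)) by apply/k_pad; exists (ulsubmx X).
  by have := g_eq0 XT (k_skew kD) (orth _ kD); rewrite mxdot_pad => /mxdot_eq0.
have dr0 : drsubmx X = 0.
  apply/matrixP => i j; have /matrixP/(_ j j) := drT; rewrite !ord1 !mxE; lra.
by rewrite -[LHS]submxK /so_block ul0 dr0 urT opprK.
Qed.

(** [orth_proj] is a choice, so its value needs uniqueness, which comes from definiteness. That [X]
    qualifies holds because s is orthogonal to k, which contains m. *)
Lemma proj_m_eq X S : mm X -> ss S -> orth_proj g0 mm (X + S) = X.
Proof.
move=> mX sS; have XT := k_skew mX.1.
have ST : S^T = - S by have [/lie_algebra_SO] := sS.
have SZ Z : mm Z -> mxdot S Z = 0.
  by move=> [kZ _]; apply: g_eq0 => //; [exact: k_skew | exact: sS.2].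
apply: xget_unique.
  split=> // Z mZ; have ZT := k_skew mZ.1.
  by rewrite addrAC subrr add0r gE // SZ // mulr0.
move=> Y [mY orth]; have YT := k_skew mY.1.
have XST : (X + S - Y)^T = - (X + S - Y).
  by apply: skewB => //; rewrite linearD /= XT ST opprD.
have dY Z : mm Z -> mxdot (X - Y) Z = 0.
  move=> mZ; have ZT := k_skew mZ.1; have := g_eq0 XST ZT (orth _ mZ).
  by rewrite -addrA [S - Y]addrC addrA mxdotC mxdotDr !(mxdotC Z) SZ // addr0.
have := mxdotDr (X - Y) X (- Y); rewrite mxdotNr (dY X) // (dY Y) // subrr.
by move=> /mxdot_eq0/eqP; rewrite subr_eq0 => /eqP.
Qed.

(** Existence of the projection is not established: if none exists, [orth_proj] takes its default 0
    and the bound is trivial; otherwise it is Pythagoras. *)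
Lemma proj_m_contract Z : Z^T = - Z ->
  ip_norm g0 (orth_proj g0 mm Z) <= Num.sqrt c * Num.sqrt (mxdot Z Z).
Proof.
move=> ZT; have [[P [mP orth]]|nex] :=
    pselect (exists P, mm P /\ forall W, mm W -> g0 (Z - P) W = 0); last first.
  rewrite /orth_proj xgetPN => [|P mP]; last by apply: nex; exists P.
  rewrite /ip_norm gE ?mxdot0 ?mulr0 ?sqrtr0 ?mulr_ge0 ?sqrtr_ge0 //;
  by rewrite trmx0 oppr0.
have [mQ orthQ] := @xgetPex _ 0 [set P | mm P /\ forall W, mm W -> g0 (Z - P) W = 0]
  (ex_intro _ P (conj mP orth)).
set Q := orth_proj _ _ _; rewrite -/Q in mQ orthQ; have QT := k_skew mQ.1.
rewrite /ip_norm gE // sqrtrM ?(ltW c0) // ler_wpM2l ?sqrtr_ge0 // ler_sqrt ?mxdot_ge0 //.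
have := g_eq0 (skewB ZT QT) QT (orthQ _ mQ).
have := mxdot_ge0 (Z - Q); rewrite mxdotDr mxdotNr !mxdotBl (mxdotC Q Z); lra.
Qed.

Lemma bracket_condition_frobenius : bracket_condition g0
    [set fix_last (realify U) | U in SU R n]
    [set fix_last A | A in SO R (n * 2)] (SO R (n * 2 + 1)).
Proof.
have [C C0 bound] := bracket_bound R n.
have m0 : 0 < m%:R :> R by rewrite ltr0n muln_gt0 (ltnW hn).
(* [C] compares entries. An entry is at most the Frobenius norm, and an m x m matrix with entries at
   most b has Frobenius norm at most m b; the factor [Num.sqrt c] is common to both sides. *)
exists (m%:R * C); first exact: mulr_gt0.
move=> X Y [A [S [mA sS ->]]] [B [T [mB sT ->]]].
rewrite (proj_m_eq mA sS) (proj_m_eq mB sT).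
have [a [A' [As AE]]] := m_decomp mA; have [b [B' [Bs BE]]] := m_decomp mB.
have [x SE] := s_decomp sS; have [y TE] := s_decomp sT.
have AT := k_skew mA.1; have BT := k_skew mB.1.
have ST : S^T = - S by have [/lie_algebra_SO] := sS.
have TT : T^T = - T by have [/lie_algebra_SO] := sT.
have XT : (A + S)^T = - (A + S) by rewrite linearD /= AT ST opprD.
have YT : (B + T)^T = - (B + T) by rewrite linearD /= BT TT opprD.
apply: le_trans (proj_m_contract (lie_bracket_skew AT BT)) _.
rewrite /ip_norm gE ?lie_bracket_skew // sqrtrM ?(ltW c0) // mulrCA ler_wpM2l ?sqrtr_ge0 //.
set e := Num.sqrt (mxdot (lie_bracket (A + S) _) _).
have e0 : 0 <= e by exact: sqrtr_ge0.
have padE D z : pad D + so_block 0 z = so_block D z :> 'M[R]_(m + 1).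
  by rewrite /pad /so_block add_block_mx addr0 !add0r.
have le i j : `|lie_bracket (so_block (a *: stdJ R n + A') x) (so_block (b *: stdJ R n + B') y) i j| <= e.
  by rewrite -(padE _ x) -(padE _ y) -AE -BE -SE -TE -sqrtr_sqr ler_sqrt ?mxdot_ge0 ?entry_le_mxdot.
have := mxdot_le_entries (bound _ _ _ _ _ _ _ As Bs e0 le).
have -> : lie_bracket A B = pad (lie_bracket (a *: stdJ R n + A') (b *: stdJ R n + B')).
  rewrite AE BE /lie_bracket /pad !mulmx_block opp_block_mx add_block_mx.
  by rewrite !(mulmx0, mul0mx, addr0, oppr0).
rewrite mxdot_pad /pad block_mxKul => bd.
apply: le_trans (_ : Num.sqrt ((m%:R * (C * e)) ^+ 2) <= _).
  by rewrite ler_sqrt ?sqr_ge0.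
rewrite sqrtr_sqr ger0_norm ?mulrA //.
exact: mulr_ge0 (mulr_ge0 (ltW m0) (ltW C0)) e0.
Qed.

End Assembly.

Theorem theorem5p1 (R : realType) (n : nat) (hn : (2 <= n)%N)
    (g0 : 'M[R]_(n * 2 + 1) -> 'M[R]_(n * 2 + 1) -> R)
    (hg0 : biinvariant_inner_product (SO R (n * 2 + 1)) g0) :
  bracket_condition g0
    [set fix_last (realify U) | U in SU R n]
    [set fix_last A | A in SO R (n * 2)]
    (SO R (n * 2 + 1)).
Proof.
have [[gl gC gp] gAd] := hg0.
(* Size 5 is what [invariant_form_unique] requires. *)
have N5 : (5 <= n * 2 + 1)%N by rewrite addn1 ltnS (leq_mul hn (leqnn 2)).
pose p : 'I_(n * 2 + 1) := Ordinal (leq_trans (isT : (1 <= 5)%N) N5).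
pose q : 'I_(n * 2 + 1) := Ordinal (leq_trans (isT : (2 <= 5)%N) N5).
have pq : p != q by [].
have dT := skew_delta_tr R p q.
have dn0 : skew_delta R p q != 0.
  apply/eqP => /matrixP/(_ p q); rewrite !mxE !eqxx (negbTE pq) /= subr0 => /eqP.
  by rewrite oner_eq0.
apply: (@bracket_condition_frobenius R n hn g0 (g0 (skew_delta R p q) (skew_delta R p q) / 2)).
  by rewrite divr_gt0 //; apply: gp dn0; apply/lie_algebra_SO.
move=> X Y XT YT; apply: invariant_form_unique => //.
- by move=> a U V W /lie_algebra_SO U1 /lie_algebra_SO V1 /lie_algebra_SO W1; exact: gl.
- by move=> U V /lie_algebra_SO U1 /lie_algebra_SO V1; exact: gC.
- move=> Q U V QQ Qdet /lie_algebra_SO U1 /lie_algebra_SO V1.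
  have Qu : Q \in unitmx by rewrite unitmxE Qdet unitr1.
  have -> : Q^T = invmx Q.
    by apply: (can_inj (mulmxK Qu)); rewrite QQ mulVmx.
  exact: gAd.
Qed.
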